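(* Let $n\ge 1$ and $k\ge 2$ be integers, let $\pi/3\le\theta\le\pi$, and let $\Delta_k(S^{n-1},\theta)$ be the $k$-point bound for spherical codes in $S^{n-1}\subseteq\mathbb{R}^n$ such that any two points must be separated by angle at least $\theta$. Then $$\Delta_{k,\mathbb{R}^n}\le\sin^n(\theta/2)\,\Delta_k(S^{n-1},\theta).$$
   Context: A real kernel is positive definite if it is symmetric and $\sum_{x,y\in F}c_xc_yK(x,y)\ge 0$ for all finite sets $F$ of points and real weights $c$. For a graph whose vertex set $V$ is a topological space, $I_k$ is the topological space of independent sets of at most $k$ vertices (including the empty set), where the nonempty sets carry the quotient topology from $V^k$ and $\emptyset$ is an isolated point. $\mathcal{C}(X)$ is the space of continuous functions $X\to\mathbb{R}$. For $T\colon V^2\times I_{k-2}\to\mathbb{R}$ and $S\in I_k\setminus\{\emptyset\}$ define $$B_kT(S)=\sum_{\substack{J\subseteq S\\|J|\le k-2}}\ \sum_{\substack{x,y\in S\\\{x,y\}\cup J=S}}T(x,y,J),$$ where the inner sum is over ordered pairs $(x,y)$. $\Delta_k(S^{n-1},\theta)$: let $V=S^{n-1}$ be the graph in which distinct points $x,y$ are adjacent if and only if the angle between them is less than $\theta$. Then $\Delta_k(S^{n-1},\theta)$ is the infimum of $M$ over all kernels $K\in\mathcal{C}(V^2\times I_{k-2})$ and real numbers $M$ such that (1) $(x,y)\mapsto K(x,y,J)$ is positive definite for each fixed $J\in I_{k-2}$; (2) $B_kK(\{x\})\le M-1$ for all $x\in V$ and $B_kK(\{x,y\})\le-2$ for all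 $\{x,y\}\in I_2$ with $x\ne y$; (3) $B_kK(S)\le 0$ for all $S\in I_k$ with $|S|\ge 3$. $\Delta_{k,\mathbb{R}^n}$: let $\mathbb{R}^n$ be the graph in which $(x,y)$ is an edge if and only if $0<|x-y|<2$, with $I_k$ now denoting the topological space of independent sets of at most $k$ vertices in this graph on $\mathbb{R}^n$ (including the empty set), where the nonempty sets carry the quotient topology from $(\mathbb{R}^n)^k$ and $\emptyset$ is an isolated point, and with $I_{k-2}$ defined in the same way with $k-2$ in place of $k$. Then $\Delta_{k,\mathbb{R}^n}$ is the infimum of $\operatorname{vol}(B_1^n)\,B_kf(\{0\})$ ($B_1^n$ the closed unit ball) over all continuous functions $f\colon\mathbb{R}^n\times\mathbb{R}^n\times I_{k-2}\to\mathbb{R}$ satisfying (1) $f(x,y,J)=f(x+z,y+z,J+z)$ for all $x,y,z\in\mathbb{R}^n$ and $J\in I_{k-2}$, where $J+z=\{j+z:j\in J\}$; (2) $(x,y)\mapsto f(x,y,J)$ is positive definite for each fixed $J$; (3) $B_kf(S)\le 0$ for all $S\in I_k$ with $|S|\ge 2$; (4) $x\mapsto f(x,0,\emptyset)$ is integrable on $\mathbb{R}^n$ and $\int_{\mathbb{R}^n}f(x,0,\emptyset)\,dx=1$. *)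

(* Defs.v *)
From HB Require Import structures.
From mathcomp Require Import all_boot all_order all_algebra finmap.
From mathcomp Require Import all_classical all_reals all_analysis.

Set Implicit Arguments.
Unset Strict Implicit.
Unset Printing Implicit Defensive.

Import Order.TTheory GRing.Theory Num.Theory.
Import numFieldTopology.Exports numFieldNormedType.Exports.

Local Open Scope fset_scope.
Local Open Scope classical_set_scope.
Local Open Scope ring_scope.

Section IndependentSets.
Variables (V : choiceType) (adj : rel V).

Definition independent (S : {fset V}) : bool :=
  [forall x : S, forall y : S, ~~ adj (val x) (val y)].

Lemma independentP (S : {fset V}) :
  reflect {in S &, forall x y, ~~ adj x y} (independent S).
Proof.
apply: (iffP idP) => [/forallP h x y xS yS|h].
  by have /forallP/(_ [` yS]) := h [` xS].
apply/forallP => x; apply/forallP => y; exact: (h _ _ (valP x) (valP y)).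
Qed.

Record indep (k : nat) := Indep {
  indep_set :> {fset V};
  indepP : independent indep_set && (#|` indep_set| <= k)%N }.

HB.instance Definition _ k := [isSub for @indep_set k].
HB.instance Definition _ k := [Choice of indep k by <:].

Lemma indep0_subproof k : independent fset0 && (#|` (fset0 : {fset V})| <= k)%N.
Proof. by rewrite cardfs0 andbT; apply/independentP => x y; rewrite inE. Qed.

Definition indep0 k : indep k := Indep (indep0_subproof k).

End IndependentSets.

Definition points (V : choiceType) k (t : 'I_k -> V) : {fset V} :=
  [fset t i | i in 'I_k].

Section IndependentSetsTopology.
Variables (V : topologicalType) (adj : rel V) (k : nat).

Definition indep_tuple : set {ptws 'I_k -> V} :=
  [set t | independent adj (points t)].

Lemma indep_of_tuple_subproof (t : indep_tuple) :
  independent adj (points (val t)) && (#|` points (val t)| <= k)%N.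
Proof.
apply/andP; split; first by case: t => t /= /set_mem.
by rewrite (leq_trans (leq_imfset_card _ _ _))// size_enum_ord.
Qed.

Definition indep_of_tuple (t : indep_tuple) : indep adj k :=
  Indep (indep_of_tuple_subproof t).

(* For [0 < k] the image of [indep_of_tuple] is the set of nonempty elements, so
   these are the unions of an open set of the quotient topology on the nonempty
   sets and of an arbitrary subset of [{fset0}]. For [k = 0], [indep adj 0] is
   the point [fset0]. *)
Definition indep_open : set_system (indep adj k) :=
  [set U | open (indep_of_tuple @^-1` U)].

Let indep_openT : indep_open setT.
Proof. by rewrite /indep_open /= preimage_setT; exact: openT. Qed.

Let indep_openI : setI_closed indep_open.
Proof. by move=> A B oA oB; rewrite /indep_open /= preimage_setI; exact: openI. Qed.

Let indep_open_bigU (I : Type) (f : I -> set (indep adj k)) :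
  (forall i, indep_open (f i)) -> indep_open (\bigcup_i f i).
Proof.
move=> of_; rewrite /indep_open /= preimage_bigcup.
by apply: bigcup_open => i _; exact: of_.
Qed.

HB.instance Definition _ := isOpenTopological.Build (indep adj k)
  indep_openT indep_openI indep_open_bigU.

End IndependentSetsTopology.

Section LebesgueTuple.
Variable R : realType.
Local Notation mR := (measurableTypeR R).
Local Open Scope ereal_scope.

Section Step.
Variable n : nat.
Variable m : {sigma_finite_measure set (n.-tuple mR) -> \bar R}.

Definition tcons (p : mR * n.-tuple mR) : n.+1.-tuple mR := [tuple of p.1 :: p.2].

Lemma measurable_tcons : measurable_fun setT tcons.
Proof. by apply: measurable_cons. Qed.

Definition lebesgue_step : set (n.+1.-tuple mR) -> \bar R :=
  pushforward (@lebesgue_measure R \x m) tcons.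

Let lebesgue_step0 : lebesgue_step set0 = 0.
Proof. by rewrite /lebesgue_step /pushforward preimage_set0 measure0. Qed.

Let lebesgue_step_ge0 A : 0 <= lebesgue_step A.
Proof. exact: (measure_ge0 (@lebesgue_measure R \x m)). Qed.

Let lebesgue_step_sigma_additive : semi_sigma_additive lebesgue_step.
Proof.
move=> F mF tF mUF; rewrite /lebesgue_step /pushforward preimage_bigcup.
apply: measure_semi_sigma_additive.
- by move=> i; rewrite -[X in measurable X]setTI; exact: measurable_tcons.
- apply/trivIsetP => /= i j _ _ ij; rewrite -preimage_setI.
  by move/trivIsetP : tF => /(_ _ _ _ _ ij) ->//; rewrite preimage_set0.
- by rewrite -preimage_bigcup -[X in measurable X]setTI; exact: measurable_tcons.
Qed.

HB.instance Definition _ := isMeasure.Build _ _ _ lebesgue_step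
  lebesgue_step0 lebesgue_step_ge0 lebesgue_step_sigma_additive.

Let lebesgue_step_sigma_finite : sigma_finite setT lebesgue_step.
Proof.
have /sigma_finiteP[F [TF ndF Foo]] := sigma_finiteT (@lebesgue_measure R).
have /sigma_finiteP[G [TG ndG Goo]] := sigma_finiteT m.
exists (fun i => [set t | F i (thead t) /\ G i [tuple of behead t]]).
  apply/esym; rewrite -subTset => t _.
  have [i _ Fi] : (\bigcup_i F i) (thead t) by rewrite -TF.
  have [j _ Gj] : (\bigcup_i G i) [tuple of behead t] by rewrite -TG.
  exists (maxn i j) => //; split.
  - by move: Fi; exact/subsetPset/ndF/leq_maxl.
  - by move: Gj; exact/subsetPset/ndG/leq_maxr.
move=> i; have [mF Foo'] := Foo i; have [mG Goo'] := Goo i; split.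
  apply: measurableI.
    by rewrite -[X in measurable X]setTI; exact: measurable_tnth.
  by rewrite -[X in measurable X]setTI; exact: measurable_behead.
rewrite /lebesgue_step /pushforward (_ : _ @^-1` _ = F i `*` G i).
  by rewrite product_measure1E// lte_mul_pinfty// ge0_fin_numE.
apply/seteqP; split => -[x t] /=; rewrite theadE (_ : [tuple of _] = t) //;
  exact/val_inj.
Qed.

HB.instance Definition _ := Measure_isSigmaFinite.Build _ _ _ lebesgue_step
  lebesgue_step_sigma_finite.

End Step.

Fixpoint lebesgue_tuple n : {sigma_finite_measure set (n.-tuple mR) -> \bar R} :=
  match n with
  | 0 => \d_([tuple] : 0.-tuple mR)
  | n'.+1 => lebesgue_step (lebesgue_tuple n')
  end.

Lemma lebesgue_tuple_box n (a b : n.-tuple R) :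
  (forall i, tnth a i <= tnth b i)%R ->
  lebesgue_tuple n [set t | forall i, tnth a i <= tnth t i <= tnth b i]%R =
  (\prod_(i < n) (tnth b i - tnth a i))%:E.
Proof.
elim: n a b => [|n IH] a b ab.
  rewrite big_ord0 /= diracE mem_set//= => -[] //.
case/tupleP: a ab => a0 a ab; case/tupleP: b ab => b0 b ab.
rewrite big_ord_recl !tnth0 /= /lebesgue_step /pushforward.
rewrite (_ : _ @^-1` _ = `[a0, b0]%classic `*`
    [set t | forall i, tnth a i <= tnth t i <= tnth b i]%R); last first.
  apply/seteqP; split => -[x t] /=.
    move=> h; split; first by have := h ord0; rewrite !tnth0 in_itv.
    by move=> i; have := h (lift ord0 i); rewrite !tnthS.
  rewrite in_itv/= => -[h0 h] i; case: (unliftP ord0 i) => [j ->|->].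
    by rewrite !tnthS; exact: h.
  by rewrite !tnth0.
rewrite product_measure1E//; last first.
  rewrite [X in measurable X](_ : _ =
      \bigcap_(i in [set: 'I_n]) ((@tnth n mR ^~ i) @^-1` `[tnth a i, tnth b i]%classic)).
    apply: fin_bigcap_measurable => // i _.
    have := @measurable_tnth _ mR n i measurableT _
      (measurable_itv `[tnth a i, tnth b i]).
    by rewrite setTI.
  apply/seteqP; split => t /= h i; first by rewrite /= in_itv/= h.
  by have := h i I; rewrite /= in_itv.
have ab0 := ab ord0; rewrite !tnth0 in ab0.
rewrite IH; last by move=> i; have := ab (lift ord0 i); rewrite !tnthS.
under [in RHS]eq_bigr do rewrite !tnthS.
rewrite [X in X * _](_ : _ = (b0 - a0)%:E) -?EFinM//.
rewrite [LHS]lebesgue_measure_itv/= lte_fin -EFinD; case: ltP => // ba0.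
by rewrite (@le_anti _ _ a0 b0) ?ab0// subrr.
Qed.

End LebesgueTuple.

Section Euclidean.
Variables (R : realType) (n : nat).

Definition row_of_tuple (t : n.-tuple R) : 'rV[R]_n := \row_i tnth t i.

Definition vol (A : set 'rV[R]_n) : \bar R :=
  lebesgue_tuple R n (row_of_tuple @^-1` A).

Definition dotp (x y : 'rV[R]_n) : R := \sum_i x 0 i * y 0 i.

(* The norm [`|x|] of the library on ['rV_n] is the sup norm. *)
Definition enorm (x : 'rV[R]_n) : R := Num.sqrt (dotp x x).

Definition unit_ball : set 'rV[R]_n := [set x | enorm x <= 1].

Definition unit_sphere : set 'rV[R]_n := [set x | enorm x = 1].

Definition sphere_adj (theta : R) : rel unit_sphere :=
  fun x y => (x != y) && (acos (dotp (val x) (val y)) < theta).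

Definition space_adj : rel 'rV[R]_n :=
  fun x y => 0 < enorm (x - y) < 2.

End Euclidean.

Section Bounds.
Variable R : realType.

Definition positive_definite (V : choiceType) (K : V -> V -> R) : Prop :=
  (forall x y, K x y = K y x) /\
  forall (F : {fset V}) (c : V -> R),
    0 <= \sum_(x <- F) \sum_(y <- F) c x * c y * K x y.

(* If [S] is independent then every [J] in the sum belongs to [I_(k-2)], and
   the default value [0] is not used. *)
Definition Bop (V : choiceType) (adj : rel V) (k : nat)
    (T : V * V * indep adj (k - 2) -> R) (S : {fset V}) : R :=
  \sum_(J <- fpowerset S | (#|` J| <= k - 2)%N)
    \sum_(x <- S) \sum_(y <- S | ([fset x; y] `|` J)%fset == S)
      oapp (fun J' => T (x, y, J')) 0 (insub J).

Definition Delta_sphere (k n : nat) (theta : R) : \bar R :=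
  let V : topologicalType := @unit_sphere R n in
  let adj : rel V := sphere_adj theta in
  ereal_inf [set M%:E | M in [set M : R |
    exists K : V * V * indep adj (k - 2) -> R,
    [/\ continuous K,
        forall J, positive_definite (fun x y => K (x, y, J)),
        forall x, Bop K [fset x] <= M - 1,
        forall x y, x != y -> independent adj [fset x; y] ->
          Bop K [fset x; y] <= - 2
      & forall S : indep adj k, (3 <= #|` S|)%N -> Bop K S <= 0]]].

Lemma translate_subproof n k (J : indep (@space_adj R n) k) (z : 'rV[R]_n) :
  let S := [fset j + z | j in (J : {fset _})] in
  independent (@space_adj R n) S && (#|` S| <= k)%N.
Proof.
case: J => J /= /andP[/independentP iJ cJ]; apply/andP; split.
  apply/independentP => _ _ /imfsetP[x /= xJ ->] /imfsetP[y /= yJ ->].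
  by rewrite /space_adj opprD addrACA subrr addr0; exact: iJ.
by rewrite (leq_trans (leq_imfset_card _ _ _)).
Qed.

Definition translate n k (J : indep (@space_adj R n) k) (z : 'rV[R]_n) :
  indep (@space_adj R n) k := Indep (translate_subproof J z).

Definition Delta_space (k n : nat) : \bar R :=
  let V := 'rV[R]_n in
  let adj : rel V := @space_adj R n in
  ereal_inf [set (vol (@unit_ball R n) * (Bop f [fset 0])%:E)%E | f in
    [set f : V * V * indep adj (k - 2) -> R |
      [/\ continuous f,
          forall x y z J, f (x, y, J) = f (x + z, y + z, translate J z),
          forall J, positive_definite (fun x y => f (x, y, J)),
          forall S : indep adj k, (2 <= #|` S|)%N -> Bop f S <= 0
        & let g (t : n.-tuple (measurableTypeR R)) :=
            (f (row_of_tuple t, 0, indep0 adj (k - 2)))%:E in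
          (lebesgue_tuple R n).-integrable setT g /\
          (\int[lebesgue_tuple R n]_t g t = 1)%E]]].

End Bounds.

(* Main.v *)
(* Let s = sin (theta / 2) and let A be the open ball of radius 1 / s in R^n without its
   center.  Two points of A at distance at least 2 are seen from the origin under an angle of
   at least theta (this is where theta >= pi / 3, that is 1 / s <= 2, enters), so radial
   projection maps packings contained in A to spherical codes.  Given a feasible kernel K0 on
   the sphere with bound M, put K = K0 + 1_{J = empty} and let f (x, y, J) be the integral over
   all z in R^n of K (proj (x + z), proj (y + z), proj (J + z)), where the integrand is set to
   0 unless all the points lie in A.  Then f is translation invariant, positive definite and
   continuous, and B_k f (F) is the integral over z of B_k K (proj (F + z)), restricted to the z
   with F + z contained in A; it is nonpositive if F has at least two points and is at most
   M vol A if F = {0}.  By Fubini, the integral of f (x, 0, empty) is the double integral of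
   K (proj u, proj v, empty) over A x A, which is at least (vol A)^2 since K0 is positive
   definite.  Normalizing f gives the objective value at most
   vol B_1 * M vol A / (vol A)^2 = M s^n. *)
Require Import Defs.
From mathcomp Require Import all_boot all_order all_algebra finmap.
From mathcomp Require Import all_classical all_reals all_analysis.
From mathcomp Require Import measurable_realfun zify ring lra.

Set Implicit Arguments.
Unset Strict Implicit.
Unset Printing Implicit Defensive.

Import Order.TTheory GRing.Theory Num.Theory.
Import numFieldTopology.Exports numFieldNormedType.Exports.

Local Open Scope fset_scope.
Local Open Scope classical_set_scope.
Local Open Scope ring_scope.

(** * Lebesgue measure on tuples *)

(** Two points at distance 1/s from the origin that are seen under the angle theta are exactly 2
    (1/s) sin (theta / 2) = 2 apart, which is where the radius comes from. The centre is removed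
    because radial projection has no limit there. The obstacle is that cutting off outside A makes
    the integrand jump, so continuity of f cannot be inherited pointwise. For a fixed configuration
    the jumps happen only at those z that move one of its finitely many points onto the centre or
    onto the boundary sphere. Since n >= 1 these z form a null set, and dominated convergence
    applies. The majorant is a constant on a large ball; the constant exists because the sphere, and
    with it the space of spherical codes of bounded size, is compact. The sigma-algebra lives on
    tuples whereas continuity is stated for row vectors. Rounding to a grid bridges this gap: it
    yields measurability, and it also reduces the sign of the double integral to finite positive
    definite forms. *)

Section LebesgueTupleTheory.
Variable R : realType.
Local Notation mR := (measurableTypeR R).
Local Notation leb := (@lebesgue_measure R).
Local Open Scope ereal_scope.

(** Scaled by [r], the pushforward of [leb] along [x => r * x + a] gives half-open intervals their
    length, so it is [leb] by uniqueness of Lebesgue measure. *)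
Lemma lebesgue_measure_affine (r a : R) (E : set mR) : (0 < r)%R ->
  measurable E -> leb ((fun x => r * x + a)%R @^-1` E) = r^-1%:E * leb E.
Proof.
move=> r0 mE.
have mf : measurable_fun setT (fun x : mR => (r * x + a)%R : mR).
  by apply: measurable_funD => //; exact: measurable_funM.
pose f : mR -> mR := fun x => (r * x + a)%R.
pose m := measure_function_pushforward__canonical__measure_function_Measure leb mf.
have mH A : measurable A -> leb A = r%:E * leb (f @^-1` A).
  apply: (@lebesgue_measure_unique R (mscale (NngNum (ltW r0)) m)) => X [[x y] /= _ <-].
  rewrite /mscale /= /pushforward.
  have -> : f @^-1` `]x, y]%classic = `]((x - a) / r)%R, ((y - a) / r)%R]%classic.
    apply/seteqP; split => z /=; rewrite !in_itv/= ltr_pdivrMr// ler_pdivlMr//.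
      by rewrite ltrBlDr lerBrDr /f [(z * r)%R]mulrC.
    by rewrite ltrBlDr lerBrDr /f [(z * r)%R]mulrC.
  rewrite !lebesgue_measure_itv/= !lte_fin ltr_pM2r ?invr_gt0//.
  rewrite ltrD2r; case: ifP => xy; last by rewrite mule0.
  rewrite -!EFinB -EFinM; congr EFin.
  rewrite -mulrBl mulrC divfK ?gt_eqF//; lra.
by rewrite (mH _ mE) muleA -EFinM mulVf ?gt_eqF// mul1e.
Qed.

Lemma lebesgue_tupleS n (E : set (n.+1.-tuple mR)) :
  lebesgue_tuple R n.+1 E =
  \int[leb]_x lebesgue_tuple R n [set t | E (tcons (x, t))].
Proof.
rewrite /= /lebesgue_step /pushforward /product_measure1.
by apply: eq_integral => x _ /=; rewrite xsectionE.
Qed.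

Definition affine_tuple n (r : R) (a : 'I_n -> R) (t : n.-tuple mR) : n.-tuple mR :=
  [tuple (r * tnth t i + a i)%R | i < n].

Lemma measurable_affine_tuple n r a : measurable_fun setT (@affine_tuple n r a).
Proof.
apply/measurable_fun_tnthP => i; rewrite /affine_tuple.
rewrite (_ : _ \o _ = fun t : n.-tuple mR => (r * tnth t i + a i)%R); last first.
  by apply/funext => t /=; rewrite tnth_mktuple.
apply: measurable_funD => //; apply: measurable_funM => //.
exact: measurable_tnth.
Qed.

Lemma measurable_tcons_section n (E : set (n.+1.-tuple mR)) (x : mR) : measurable E ->
  measurable [set t | E (tcons (x, t))].
Proof.
move=> mE.
have : measurable_fun setT (fun t : n.-tuple mR => tcons (x, t)).
  by apply: (measurableT_comp (@measurable_tcons R n)); exact: measurable_pair1.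
by move=> /(_ measurableT _ mE); rewrite setTI.
Qed.

(** This serves twice: [r = 1] gives translation invariance, [a = 0] the scaling of ball volumes.
    The induction uses the one-dimensional formula for the head and the induction hypothesis for the
    slices. *)
Lemma lebesgue_tuple_affine n (r : R) (a : 'I_n -> R) (E : set (n.-tuple mR)) :
  (0 < r)%R -> measurable E ->
  lebesgue_tuple R n (affine_tuple r a @^-1` E) = (r ^- n)%:E * lebesgue_tuple R n E.
Proof.
move=> r0; elim: n a E => [|n IH] a E mE.
  rewrite expr0 invr1 mul1e; congr (lebesgue_tuple R 0 _).
  by apply/seteqP; split => t /=; rewrite (_ : affine_tuple _ _ _ = t)//;
    apply: eq_from_tnth => -[].
have mT x : measurable [set t | E (tcons (x, t))] by exact: measurable_tcons_section.
rewrite lebesgue_tupleS [in RHS]lebesgue_tupleS.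
(* The slice of the preimage at [x] is the affine preimage of the slice of [E] at
   [r * x + a ord0]. *)
transitivity (\int[leb]_x ((r ^- n)%:E *
    lebesgue_tuple R n [set t | E (tcons ((r * x + a ord0)%R, t))])).
  apply: eq_integral => x _; rewrite -(IH (a \o lift ord0))//.
  congr (lebesgue_tuple R n _); apply/seteqP.
  suff h t : affine_tuple r a (tcons (x, t)) =
      tcons ((r * x + a ord0)%R, affine_tuple r (a \o lift ord0) t).
    by split => t /=; rewrite h.
  apply: eq_from_tnth => i; rewrite tnth_mktuple.
  by case: (unliftP ord0 i) => [j ->|->]; rewrite ?tnthS ?tnth0// tnth_mktuple.
have mg : measurable_fun setT
    (fun x : mR => lebesgue_tuple R n [set t | E (tcons (x, t))]).
  rewrite (_ : (fun _ => _) =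
      lebesgue_tuple R n \o xsection (@tcons R n @^-1` E)); last first.
    by apply/funext => x /=; rewrite xsectionE.
  apply: measurable_fun_xsection.
  by rewrite -[X in measurable X]setTI; exact: measurable_tcons.
have mf : measurable_fun setT (fun x : mR => (r * x + a ord0)%R : mR).
  by apply: measurable_funD => //; exact: measurable_funM.
rewrite ge0_integralZl ?lee_fin ?invr_ge0 ?exprn_ge0 ?(ltW r0)//; last first.
  exact: (measurableT_comp mg mf).
rewrite exprS invfM mulrC EFinM -muleA; congr (_ * _).
pose f x := lebesgue_tuple R n [set t | E (tcons (x, t))].
transitivity (\int[pushforward leb (fun x : mR => (r * x + a ord0)%R : mR)]_x f x).
  by rewrite ge0_integral_pushforward//= => x _; exact: measure_ge0.
have r1 : (0 <= r^-1)%R by rewrite invr_ge0 ltW.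
transitivity (\int[mscale (NngNum r1) leb]_x f x).
  apply: eq_measure_integral => A mA _.
  by rewrite /mscale/= /pushforward lebesgue_measure_affine.
rewrite ge0_integral_mscale//= => x _; exact: measure_ge0.
Qed.

(** The slices of a sphere are spheres of lower dimension, down to at most two points on the line.
    Since [c] is arbitrary, possibly negative, [c - (x + p ord0) ^+ 2] can take its place in the
    induction. *)
Lemma lebesgue_tuple_quadric_null n (p : 'I_n.+1 -> R) (c : R) :
  lebesgue_tuple R n.+1
    [set t | \sum_(i < n.+1) (tnth t i + p i) ^+ 2 = c]%R = 0.
Proof.
have mE m (q : 'I_m -> R) (d : R) : measurable
    [set t : m.-tuple mR | \sum_(i < m) (tnth t i + q i) ^+ 2 = d]%R.
  have : measurable_fun setT (fun t : m.-tuple mR => \sum_(i < m) (tnth t i + q i) ^+ 2)%R.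
    apply: measurable_sum => i; apply: measurable_funX; apply: measurable_funD => //.
    exact: measurable_tnth.
  by move=> /(_ measurableT [set d] (measurable_set1 _)); rewrite setTI.
elim: n p c => [|n IH] p c; rewrite lebesgue_tupleS.
  pose S : set mR := [set x | (x + p ord0) ^+ 2 = c]%R.
  have cS : countable S.
    apply: (@sub_countable _ _ _ [set Num.sqrt c - p ord0; - Num.sqrt c - p ord0]%R).
      apply: subset_card_le => x; rewrite /S/= => <-; rewrite sqrtr_sqr.
      by case: ler0P => _; [right|left]; rewrite ?opprK addrK.
    by apply: finite_set_countable; exact: finite_set2.
  (* The measure on 0-tuples is a Dirac mass, so the slice at [x] has measure 1 or 0 according to
     whether [x] is in [S]. *)
  transitivity (\int[leb]_x (\1_S x)%:E).
    apply: eq_integral => x _; rewrite /= diracE indicE; congr (_%:R%:E).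
    congr nat_of_bool; apply/idP/idP; rewrite !inE/= big_ord_recl big_ord0 addr0 tnth0//.
  rewrite integral_indic// ?setIT; first exact: countable_lebesgue_measure0.
  exact: countable_measurable.
apply: integral0_eq => x _.
rewrite -[RHS](IH (p \o lift ord0) (c - (x + p ord0) ^+ 2)%R).
congr (lebesgue_tuple R n.+1 _); apply/seteqP; split => t /=.
  rewrite big_ord_recl tnth0 => <-; rewrite addrC addKr.
  by apply: eq_bigr => i _; rewrite tnthS.
move=> h; rewrite big_ord_recl tnth0.
rewrite [X in (_ + X)%R](_ : _ = c - (x + p ord0) ^+ 2)%R; first by rewrite addrC subrK.
by rewrite -h; apply: eq_bigr => i _; rewrite tnthS.
Qed.
End LebesgueTupleTheory.

(** * Euclidean inner product and norm *)

Section EuclideanTheory.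
Variables (R : realType) (n : nat).
Implicit Types (x y z : 'rV[R]_n).

Lemma dotpC x y : dotp x y = dotp y x.
Proof. by apply: eq_bigr => i _; rewrite mulrC. Qed.

Lemma dotpDl x y z : dotp (x + y) z = dotp x z + dotp y z.
Proof. by rewrite /dotp -big_split; apply: eq_bigr => i _; rewrite mxE mulrDl. Qed.

Lemma dotpZl (a : R) x y : dotp (a *: x) y = a * dotp x y.
Proof. by rewrite /dotp mulr_sumr; apply: eq_bigr => i _; rewrite mxE mulrA. Qed.

Lemma dotpDr x y z : dotp z (x + y) = dotp z x + dotp z y.
Proof. by rewrite dotpC dotpDl !(dotpC z). Qed.

Lemma dotpZr (a : R) x y : dotp x (a *: y) = a * dotp x y.
Proof. by rewrite dotpC dotpZl dotpC. Qed.

Lemma dotpNl x y : dotp (- x) y = - dotp x y.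
Proof. by rewrite -scaleN1r dotpZl mulN1r. Qed.

Lemma dotpNr x y : dotp x (- y) = - dotp x y.
Proof. by rewrite dotpC dotpNl dotpC. Qed.

Lemma dotp_ge0 x : 0 <= dotp x x.
Proof. by apply: sumr_ge0 => i _; rewrite -expr2 sqr_ge0. Qed.

Lemma dotp_eq0 x : (dotp x x == 0) = (x == 0).
Proof.
apply/idP/eqP => [|->]; last first.
  by rewrite /dotp big1// => i _; rewrite mxE mulr0.
rewrite psumr_eq0; last by move=> i _; rewrite -expr2 sqr_ge0.
move=> /allP h; apply/rowP => i; rewrite mxE; apply/eqP.
by have := h i (mem_index_enum _); rewrite mulf_eq0 orbb.
Qed.

Lemma enorm_ge0 x : 0 <= enorm x.
Proof. exact: sqrtr_ge0. Qed.

Lemma sqr_enorm x : enorm x ^+ 2 = dotp x x.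
Proof. by rewrite sqr_sqrtr// dotp_ge0. Qed.

Lemma enorm_eq0 x : (enorm x == 0) = (x == 0).
Proof. by rewrite -dotp_eq0 -sqr_enorm sqrf_eq0. Qed.

Lemma enorm_gt0 x : (0 < enorm x) = (x != 0).
Proof. by rewrite lt_def enorm_eq0 enorm_ge0 andbT. Qed.

Lemma enorm0 : enorm (0 : 'rV[R]_n) = 0.
Proof. by apply/eqP; rewrite enorm_eq0. Qed.

Lemma enormZ (a : R) x : enorm (a *: x) = `|a| * enorm x.
Proof.
by rewrite /enorm dotpZl dotpZr mulrA -expr2 sqrtrM ?sqr_ge0// sqrtr_sqr.
Qed.

Lemma enormN x : enorm (- x) = enorm x.
Proof. by rewrite /enorm dotpNl dotpNr opprK. Qed.

Lemma enorm_distC x y : enorm (x - y) = enorm (y - x).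
Proof. by rewrite -enormN opprB. Qed.

Lemma sqr_enormB x y : enorm (x - y) ^+ 2 = enorm x ^+ 2 + enorm y ^+ 2 - 2 * dotp x y.
Proof. by rewrite !sqr_enorm dotpDl !dotpDr !dotpNl !dotpNr (dotpC y x); ring. Qed.

(** Cauchy-Schwarz: with [a = enorm x] and [b = enorm y], the squared norm of [b *: x - a *: y] is
    [2 * (a * b) * (a * b - dotp x y)]. *)
Lemma dotp_le x y : dotp x y <= enorm x * enorm y.
Proof.
have [->|x0] := eqVneq x 0.
  by rewrite enorm0 mul0r /dotp big1// => i _; rewrite mxE mul0r.
have [->|y0] := eqVneq y 0.
  by rewrite enorm0 mulr0 /dotp big1// => i _; rewrite mxE mulr0.
have := sqr_ge0 (enorm (enorm y *: x - enorm x *: y)).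
rewrite sqr_enormB !enormZ !ger0_norm ?enorm_ge0// dotpZl dotpZr.
move: x0 y0; rewrite -!enorm_gt0; move: (enorm x) (enorm y) => a b a0 b0 h.
have : 0 <= 2 * (a * b) * (a * b - dotp x y) by move: h; congr (_ <= _); ring.
by rewrite pmulr_rge0 ?subr_ge0// mulr_gt0// mulr_gt0.
Qed.

Lemma enormD x y : enorm (x + y) <= enorm x + enorm y.
Proof.
have h := dotp_le x y.
rewrite -(@ler_pXn2r _ 2)// ?nnegrE ?addr_ge0 ?enorm_ge0//.
by have := sqr_enormB x (- y); rewrite opprK enormN dotpNr => ->; lra.
Qed.

Lemma enorm_triangle x y z : enorm (x - y) <= enorm (x - z) + enorm (z - y).
Proof. by have := enormD (x - z) (z - y); rewrite addrA subrK. Qed.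

Lemma coord_le_enorm x i : `|x 0 i| <= enorm x.
Proof.
rewrite -sqrtr_sqr ler_wsqrtr// /dotp (bigD1 i)//= -expr2 lerDl.
by apply: sumr_ge0 => j _; rewrite -expr2 sqr_ge0.
Qed.

Lemma cvg_row {T : Type} {F : set_system T} {FF : Filter F}
    (u : T -> 'rV[R]_n) x :
  (forall i, u t 0 i @[t --> F] --> x 0 i) -> u @ F --> x.
Proof.
move=> ux A [P nP sPA].
have : F [set t | forall i, P 0 i (u t 0 i)].
  by apply: (@filter_forall T 'I_n (fun i t => P 0 i (u t 0 i))) => i; exact: (ux i _ (nP 0 i)).
move=> h; rewrite /nbhs/=; apply: filterS h => t Pt; apply: sPA => i j; rewrite (ord1 i); exact: Pt.
Qed.

Lemma cvg_coord {T : Type} {F : set_system T} {FF : Filter F}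
    (u : T -> 'rV[R]_n) x i :
  u @ F --> x -> u t 0 i @[t --> F] --> x 0 i.
Proof. move=> ux; exact: (cvg_comp u
  (fun y : 'rV_n => y 0 i) ux (@coord_continuous R 1 n 0 i x)). Qed.

Lemma cvg_dotp {T : Type} {F : set_system T} {FF : Filter F}
    (u v : T -> 'rV[R]_n) x y :
  u @ F --> x -> v @ F --> y -> dotp (u t) (v t) @[t --> F] --> dotp x y.
Proof.
move=> ux vy; rewrite /dotp; apply: (cvg_big (@add_continuous R)) => //= i _.
by apply: cvgM; exact: cvg_coord.
Qed.

Lemma cvg_enorm {T : Type} {F : set_system T} {FF : Filter F}
    (u : T -> 'rV[R]_n) x :
  u @ F --> x -> enorm (u t) @[t --> F] --> enorm x.
Proof.
move=> ux; exact: (cvg_comp _ _ (cvg_dotp ux ux) (@sqrt_continuous R _)).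
Qed.

Lemma enorm_continuous : continuous (@enorm R n).
Proof. by move=> x; exact: (cvg_enorm (F := nbhs x) (u := id) (x := x) cvg_id). Qed.

End EuclideanTheory.

(** * Measurability and translation of functions of row vectors *)

Section LebesgueRow.
Variables (R : realType) (n : nat).
Local Notation mR := (measurableTypeR R).
Local Notation mu := (lebesgue_tuple R n).
Local Notation row := (@row_of_tuple R n).

Lemma row_of_tupleE (t : n.-tuple mR) i : row t 0 i = tnth t i.
Proof. by rewrite mxE. Qed.

Lemma affine_tupleE (r : R) (x : 'rV[R]_n) (t : n.-tuple mR) :
  row (affine_tuple r (x 0) t) = r *: row t + x.
Proof. by apply/rowP => i; rewrite !mxE tnth_mktuple. Qed.

(** Here and below, measurability of a row-valued map is expressed coordinate by coordinate, since
    the sigma-algebra is carried by tuples. *)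
Lemma measurable_coord_dotp d (T : measurableType d) m (h : T -> 'rV[R]_m) :
  (forall i, measurable_fun setT (fun t => h t 0 i)) ->
  measurable_fun setT (fun t => dotp (h t) (h t)).
Proof. by move=> mh; apply: measurable_sum => i; exact: measurable_funM. Qed.

Lemma measurable_coord_enorm d (T : measurableType d) m (h : T -> 'rV[R]_m) :
  (forall i, measurable_fun setT (fun t => h t 0 i)) ->
  measurable_fun setT (fun t => enorm (h t)).
Proof.
move=> mh; exact: (measurableT_comp (continuous_measurable_fun (@sqrt_continuous R))
  (measurable_coord_dotp mh)).
Qed.

Lemma measurable_translate (x : 'rV[R]_n) i :
  measurable_fun setT (fun t : n.-tuple mR => (x + row t) 0 i : mR).
Proof.
rewrite (_ : (fun _ => _) = fun t : n.-tuple mR => x 0 i + tnth t i); last first.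
  by apply/funext => t; rewrite !mxE.
by apply: measurable_funD => //; exact: measurable_tnth.
Qed.

Lemma integral_translate (x : 'rV[R]_n) (g : 'rV[R]_n -> \bar R) :
  measurable_fun setT (g \o row) -> mu.-integrable setT (g \o row) ->
  (\int[mu]_t g (x + row t)%R = \int[mu]_t g (row t))%E.
Proof.
move=> mg ig.
pose T y := @affine_tuple R n 1 ((y : 'rV[R]_n) 0).
have mT y : measurable_fun setT (T y) by exact: measurable_affine_tuple.
have TE y t : row (T y t) = y + row t by rewrite affine_tupleE scale1r addrC.
have muT y A : measurable A -> pushforward mu (T y) A = mu A.
  by move=> mA; rewrite /pushforward lebesgue_tuple_affine// expr1n invr1 mul1e.
(* As [g] may change sign, the change of variables needs the composite to be integrable; the
   integral of its absolute value is unchanged because [mu] is its own pushforward. *)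
have igT : mu.-integrable setT ((g \o row) \o T x).
  apply/integrableP; split; first exact: measurableT_comp mg (mT x).
  move/integrableP : ig => [_]; apply: le_lt_trans.
  rewrite [leRHS](eq_measure_integral (pushforward mu (T x))); last first.
    move=> A mA _. exact/esym/muT.
  rewrite ge0_integral_pushforward//; exact: measurableT_comp.
transitivity (\int[pushforward mu (T x)]_t (g \o row) t)%E.
  rewrite integral_pushforward//; apply: eq_integral => t _ /=; by rewrite TE.
by apply: eq_measure_integral => A mA _; exact: muT.
Qed.

Lemma measurable_punctured_ball (r : R) :
  measurable [set t : n.-tuple mR | 0 < enorm (row t) < r].
Proof.
have mh : measurable_fun setT (fun t : n.-tuple mR => enorm (row t)).
  apply: measurable_coord_enorm => i.
  rewrite (_ : (fun _ => _) = fun t : n.-tuple mR => tnth t i); first exact: measurable_tnth.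
  by apply/funext => t; rewrite row_of_tupleE.
have := mh measurableT _ (measurable_itv `]0, r[%R); rewrite setTI.
by congr (measurable _); apply/seteqP; split => t /=; rewrite in_itv.
Qed.

End LebesgueRow.

(** * Grid approximation and measurability *)

Section Grid.
Variables (R : realType) (n : nat).
Implicit Types (x : 'rV[R]_n).

(** Cells have side [1 / m.+1] and are counted from [- m]. Coordinates below [- m] also get the code
    0 by truncation, which is harmless because [m] tends to infinity. *)
Definition grid_code m x (i : 'I_n) : nat := Num.truncn (m.+1%:R * (x 0 i + m%:R)).

Definition grid_point m (c : 'I_n -> nat) : 'rV[R]_n :=
  \row_i ((c i)%:R / m.+1%:R - m%:R).

Lemma grid_cvg x : grid_point m (grid_code m x) @[m --> \oo] --> x.
Proof.
have key (a b q d e : R) : 0 < e -> q <= a + b -> a + b < q + d -> d < e ->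
    `|a - (q - b)| < e.
  by move=> *; rewrite ltr_norml; apply/andP; split; lra.
apply: cvg_row => i; apply/cvgrPdist_lt => /= e e0; near=> m.
(* Once [m >= - x 0 i] the truncation no longer saturates at 0, and the rounding error is below
   [1 / m.+1]. *)
have xm : 0 <= x 0 i + m%:R.
  rewrite -lerBlDl add0r; near: m; exact: nbhs_infty_ger.
rewrite mxE /grid_code.
have /andP[h1 h2] := truncn_itv (mulr_ge0 (ler0n R m.+1) xm).
set c := Num.truncn _ in h1 h2 *.
have m0 : (0 : R) < m.+1%:R by rewrite ltr0n.
rewrite mulrC -ler_pdivrMr// in h1;
  rewrite mulrC -ltr_pdivlMr// -[c.+1]addn1 natrD mulrDl mul1r in h2.
have : m.+1%:R^-1 < e.
  by near: m; have := near_infty_natSinv_lt (PosNum e0).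
move: h1 h2; set q := c%:R / _ => h1 h2 he.
exact: key e0 h1 h2 he.
Unshelve. all: by end_near. Qed.

Lemma measurable_grid_code d (T : measurableType d) (h : T -> 'rV[R]_n) m (c : 'I_n -> nat) :
  (forall i, measurable_fun setT (fun t => h t 0 i)) ->
  measurable [set t | forall i, grid_code m (h t) i = c i].
Proof.
move=> mh.
rewrite (_ : [set t | _] = \bigcap_(i in [set: 'I_n]) [set t | grid_code m (h t) i = c i]);
  last first.
  by apply/seteqP; split => t /= ht i; [move=> _; exact: ht|exact: (ht i I)].
apply: fin_bigcap_measurable => // i _.
pose g t := m.+1%:R * (h t 0 i + m%:R).
have mg : measurable_fun setT g.
  by apply: measurable_funM => //; exact: measurable_funD.
(* The code 0 also arises from negative arguments, so the lower bound is imposed only on positive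
   codes. *)
rewrite (_ : [set t | _] = g @^-1` ([set y | y < (c i).+1%:R] `&`
   [set y | ((c i == 0%N) || ((c i)%:R <= y))])).
  rewrite -[X in measurable X]setTI; apply: mg => //; apply: measurableI.
    by have := measurable_itv `]-oo, (c i).+1%:R : R[; rewrite set_itvE.
  case: eqP => /= [_|_].
    by rewrite (_ : [set _ | _] = setT)//; apply/seteqP; split.
  by have := measurable_itv `[(c i)%:R : R, +oo[; rewrite set_itvE.
apply/seteqP; split => t; rewrite /= /grid_code -/(g t).
  move=> <-; split; first by rewrite truncnS_gt.
  case: eqP => //= /eqP; rewrite -lt0n => c0; rewrite truncn_le.
  by move: c0; rewrite truncn_gt0; exact: le_trans.
move=> [h1 h2]; apply/eqP; rewrite eqn_leq truncn_le_nat h1/=.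
by case/orP: h2 => [/eqP->//|]; case: (c i) => // k; rewrite truncn_gt_nat.
Qed.

(* [G \o h] is the limit of its compositions with the grid maps, which take countably many
   values. *)
Lemma measurable_fun_seq_continuous d (T : measurableType d) (D : set T)
    (h : T -> 'rV[R]_n) (G : 'rV[R]_n -> R) :
  (forall i, measurable_fun setT (fun t => h t 0 i)) ->
  (forall t, D t -> forall u : nat -> 'rV[R]_n, u @ \oo --> h t -> (G \o u) @ \oo --> G (h t)) ->
  measurable_fun D (G \o h).
Proof.
move=> mh cG; pose f m t := G (grid_point m (grid_code m (h t))).
apply: (@measurable_fun_cvg _ _ _ _ f) => [m|t Dt]; last first.
  by apply: cG => //; exact: grid_cvg.
apply: measurable_funTS => _ B mB; rewrite setTI.
pose E (c : {ffun 'I_n -> nat}) := if `[< B (G (grid_point m c)) >] then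
  [set t | forall i, grid_code m (h t) i = c i] else set0.
rewrite (_ : _ @^-1` _ = \bigcup_c E c).
  apply: countable_bigcupT_measurable => [|c]; first exact: countableP.
  by rewrite /E; case: ifP => _ //; exact: measurable_grid_code.
apply/seteqP; split => t /=.
  rewrite /f => Bt; exists [ffun i => grid_code m (h t) i] => //.
  rewrite /E ifT => [i|]; rewrite ?ffunE//.
  apply/asboolP; move: Bt; congr (B (G _)).
  by apply/rowP => i; rewrite !mxE ffunE.
move=> [c _]; rewrite /E; case: ifPn => // /asboolP + /= hc.
by congr (B (G _)); apply/rowP => i; rewrite !mxE hc.
Qed.

End Grid.

(** * Null spheres and volumes of balls *)

Section RowMeasure.
Variables (R : realType) (n : nat).
Local Notation mR := (measurableTypeR R).
Local Notation mu := (lebesgue_tuple R n).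
Local Notation row := (@row_of_tuple R n).

Lemma measurable_row i : measurable_fun setT (fun t : n.-tuple mR => row t 0 i : mR).
Proof.
rewrite (_ : (fun _ => _) = fun t : n.-tuple mR => tnth t i); first exact: measurable_tnth.
by apply/funext => t; rewrite row_of_tupleE.
Qed.

Lemma measurable_box (a b : n.-tuple R) :
  measurable [set t : n.-tuple mR | forall i, tnth a i <= tnth t i <= tnth b i].
Proof.
rewrite [X in measurable X](_ : _ = \bigcap_(i in [set: 'I_n])
    ((fun t : n.-tuple mR => tnth t i) @^-1` `[tnth a i, tnth b i]%classic)).
  apply: fin_bigcap_measurable => // i _.
  by rewrite -[X in measurable X]setTI; exact: measurable_tnth.
apply/seteqP; split => t /= ht i; first by rewrite /= in_itv/= ht.
by have := ht i I; rewrite /= in_itv.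
Qed.

Lemma measurable_enorm_le (r : R) : measurable [set t : n.-tuple mR | enorm (row t) <= r].
Proof.
have := measurable_coord_enorm measurable_row measurableT (measurable_itv `]-oo, r]%R).
by rewrite setTI set_itvE.
Qed.

Lemma enorm_le_finite (r : R) : (mu [set t : n.-tuple mR | (enorm (row t) <= r)%R] < +oo)%E.
Proof.
have [r0|r0] := ltP r 0.
  rewrite (_ : [set t | _] = set0) ?measure0//.
  by apply/seteqP; split => // t /=; rewrite leNgt (lt_le_trans r0)// enorm_ge0.
pose a : n.-tuple R := [tuple - r | _ < n]; pose b : n.-tuple R := [tuple r | _ < n].
have ab i : tnth a i <= tnth b i by rewrite !tnth_mktuple; lra.
have := @lebesgue_tuple_box R n a b ab.
set B := [set t | _] => muB.
have mB : measurable B := measurable_box a b.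
apply: (@le_lt_trans _ _ (mu B)); last by rewrite muB ltry.
apply: le_measure; [apply: mem_set; exact: measurable_enorm_le|exact/mem_set|].
move=> t /= tr i; rewrite !tnth_mktuple -ler_norml.
by apply: le_trans tr; rewrite -row_of_tupleE coord_le_enorm.
Qed.

Lemma enorm_eq_negligible (p : 'rV[R]_n) (c : R) : (0 < n)%N ->
  mu.-negligible [set t : n.-tuple mR | enorm (p + row t) = c].
Proof.
move: p; case: n => // m p _.
exists [set t : m.+1.-tuple mR | \sum_(i < m.+1) (tnth t i + p 0 i) ^+ 2 = c ^+ 2]; split.
- have mh : measurable_fun setT (fun t : m.+1.-tuple mR => \sum_(i < m.+1) (tnth t i + p 0 i) ^+ 2).
    apply: measurable_sum => i; apply: measurable_funX; apply: measurable_funD => //.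
    exact: measurable_tnth.
  have := mh measurableT [set c ^+ 2] (measurable_set1 _).
  by rewrite setTI.
- exact: lebesgue_tuple_quadric_null.
- move=> t /= <-; rewrite sqr_enorm; apply: eq_bigr => i _.
  by rewrite !mxE expr2 addrC.
Qed.

Lemma ball_measure_finite r : mu [set t : n.-tuple mR | 0 < enorm (row t) < r] \is a fin_num.
Proof.
rewrite ge0_fin_numE//; apply: (le_lt_trans _ (enorm_le_finite r)).
apply: le_measure; [apply: mem_set; exact: measurable_punctured_ball|apply: mem_set;
  exact: measurable_enorm_le|].
by move=> t /= /andP[_ /ltW].
Qed.

(** Dilation by [r] handles the punctured open unit ball; the closed unit ball adds only the centre
    and the unit sphere, the null spheres of radius 0 and 1. *)
Lemma vol_unit_ball_scale r : (0 < n)%N -> 0 < r ->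
  (vol (@unit_ball R n) = (r ^- n)%:E * mu [set t : n.-tuple mR | (0 < enorm (row t) < r)%R])%E.
Proof.
move=> n0 r0; rewrite -(@lebesgue_tuple_affine R n r ((0 : 'rV[R]_n) 0)) //;
  last exact: measurable_punctured_ball.
rewrite (_ : _ @^-1` _ = [set t : n.-tuple mR | 0 < enorm (row t) < 1]); last first.
  have h (t : n.-tuple mR) :
      enorm (row (affine_tuple r ((0 : 'rV[R]_n) 0) t)) = r * enorm (row t).
    by rewrite affine_tupleE addr0 enormZ ger0_norm// ltW.
  by apply/seteqP; split => t /=; rewrite h pmulr_rgt0// -ltr_pdivlMl// mulVf// gt_eqF.
rewrite /vol (_ : _ @^-1` _ = [set t : n.-tuple mR | (enorm (row t) <= 1)%R])//.
set A := [set t | _]; set B := [set t : n.-tuple mR | _].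
have mA : measurable A by exact: measurable_enorm_le.
have mB : measurable B by exact: measurable_punctured_ball.
have AB : A = B `|` (A `\` B).
  by rewrite setDUK// => t /= /andP[_ /ltW].
have mAB : measurable (A `\` B) by exact: measurableD.
rewrite AB measureU0//.
apply: measure_negligible => //.
apply: (@negligibleS _ _ _ mu ([set t : n.-tuple mR | enorm (0 + row t) = 0] `|`
  [set t : n.-tuple mR | enorm (0 + row t) = 1])); last first.
  by apply: negligibleU; exact: enorm_eq_negligible.
move=> t [/= t1] /negP; rewrite add0r negb_and -!leNgt => /orP[t0|t2].
  by left; apply/eqP; rewrite eq_le t0 enorm_ge0.
by right; apply/eqP; rewrite eq_le t1.
Qed.

Lemma ball_measure_gt0 r : (0 < n)%N -> 0 < r ->
  (0 < mu [set t : n.-tuple mR | (0 < enorm (row t) < r)%R])%E.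
Proof.
(* The box with sides [[e, 2 e]] avoids the origin, and its points have squared norm at most
   [n (2 e)^2 = n r^2 / (n + 1)^2 < r^2]. *)
move=> n0 r0; pose e := r / 2 / n.+1%:R.
have e0 : 0 < e by rewrite !divr_gt0// ltr0n.
pose a : n.-tuple R := [tuple e | _ < n]; pose b : n.-tuple R := [tuple 2 * e | _ < n].
have ab i : tnth a i <= tnth b i by rewrite !tnth_mktuple; lra.
have := @lebesgue_tuple_box R n a b ab.
set B := [set t | _] => muB.
have mB : measurable B := measurable_box a b.
apply: (@lt_le_trans _ _ (mu B)).
  rewrite muB lte_fin; apply: prodr_gt0 => i _.
  by rewrite !tnth_mktuple mulr2n mulrDl mul1r addrK.
apply: le_measure; [exact/mem_set|apply: mem_set; exact: measurable_punctured_ball|].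
move=> t /= tB; apply/andP; split.
  have := tB (Ordinal n0); rewrite !tnth_mktuple => /andP[h _].
  apply: lt_le_trans (coord_le_enorm _ (Ordinal n0)).
  by rewrite row_of_tupleE normr_gt0 gt_eqF// (lt_le_trans e0).
rewrite -(@ltr_pXn2r _ 2)// ?nnegrE ?enorm_ge0 ?(ltW r0)//.
rewrite sqr_enorm; apply: (@le_lt_trans _ _ (\sum_(i < n) (2 * e) ^+ 2)).
  apply: ler_sum => i _; rewrite row_of_tupleE -expr2.
  have := tB i; rewrite !tnth_mktuple => /andP[h1 h2].
  by rewrite ler_pXn2r ?nnegrE//; [exact: le_trans (ltW e0) h1|rewrite mulr_ge0// ltW].
rewrite sumr_const card_ord -[ltLHS]mulr_natl.
have -> : 2 * e = r / n.+1%:R by rewrite /e; field.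
rewrite expr_div_n mulrA ltr_pdivrMr ?exprn_gt0 ?ltr0n// mulrC ltr_pM2l ?exprn_gt0//.
by rewrite -natrX ltr_nat; nia.
Qed.

End RowMeasure.

(** * Double integrals of positive definite kernels *)

Section PositiveDefiniteIntegral.
Variables (R : realType) (n : nat).
Local Notation mR := (measurableTypeR R).
Local Notation mu := (lebesgue_tuple R n).
Local Notation row := (@row_of_tuple R n).
Variables (A : set 'rV[R]_n) (k : 'rV[R]_n -> 'rV[R]_n -> R) (r C : R).
Hypothesis mA : measurable [set t : n.-tuple mR | A (row t)].
Hypothesis Ar : forall u, A u -> enorm u <= r.
(** The kernel gets evaluated at grid points, which may lie outside [A]. Hence positivity and the
    bound are asked on all rows, and convergence along sequences that are not confined to [A]. *)
Hypothesis kpd : forall (I : finType) (c : I -> R) (w : I -> 'rV[R]_n),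
  0 <= \sum_i \sum_j c i * c j * k (w i) (w j).
Hypothesis kC : forall u v, `|k u v| <= C.
Hypothesis kcont : forall u v (u_ v_ : nat -> 'rV[R]_n), A u -> A v ->
  u_ @ \oo --> u -> v_ @ \oo --> v -> k (u_ m) (v_ m) @[m --> \oo] --> k u v.

Local Notation E := [set t : n.-tuple mR | A (row t)].

(** On the ball of radius [r] all codes at level [m] are below [K m], so finitely many cells,
    indexed by [code m], cover [E]. *)
Let K m := (Num.truncn (m.+1%:R * (r + m%:R))).+1.
Let code m := {ffun 'I_n -> 'I_(K m)}.
Let w m (a : code m) : 'rV[R]_n := grid_point R m (fun i => a i : nat).
Let cell m (a : code m) : set (n.-tuple mR) :=
  E `&` [set t | forall i, grid_code m (row t) i = a i].

Let mcell m (a : code m) : measurable (cell a).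
Proof.
by apply: measurableI => //; apply: measurable_grid_code; exact: measurable_row.
Qed.

Let muE : (mu E < +oo)%E.
Proof.
apply: (le_lt_trans _ (enorm_le_finite n r)).
by apply: le_measure; [exact: mem_set|apply: mem_set; exact: measurable_enorm_le|move=> t /Ar].
Qed.

Let mucell m (a : code m) : mu (cell a) \is a fin_num.
Proof.
rewrite ge0_fin_numE//; apply: le_lt_trans muE.
by apply: le_measure; [exact: mem_set|exact: mem_set|move=> t []].
Qed.

Let f m (p : n.-tuple mR * n.-tuple mR) : R :=
  \sum_(a : code m) \sum_(b : code m) k (w a) (w b) * \1_(cell a `*` cell b) p.

(** Every point of [E] lies in exactly one cell, so a single term of the double sum survives. *)
Let fE m p : f m p = \1_(E `*` E) p *
  k (grid_point R m (grid_code m (row p.1))) (grid_point R m (grid_code m (row p.2))).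
Proof.
have [[E1 E2]|nE] := pselect ((E `*` E) p); last first.
  rewrite indicE memNset// mul0r /f big1// => a _; rewrite big1// => b _.
  by rewrite indicE memNset ?mulr0// => -[[? _] [? _]]; exact: nE.
have codeP t : E t -> exists2 a : code m, cell a t &
    (grid_point R m (grid_code m (row t)) = w a) /\ forall b, cell b t -> b = a.
  move=> Et; have lt_code i : (grid_code m (row t) i < K m)%N.
    rewrite ltnS truncn_le_nat (le_lt_trans _ (truncnS_gt _))// ler_pM2l ?ltr0n//.
    by rewrite lerD2r (le_trans (ler_norm _))// (le_trans (coord_le_enorm _ _))// Ar.
  exists [ffun i => Ordinal (lt_code i)]; first by split=> // i; rewrite ffunE.
  split; first by apply/rowP => i; rewrite !mxE ffunE.
  by move=> b [_ bt]; apply/ffunP => i; rewrite ffunE; apply/val_inj; rewrite /= bt.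
have [a ca [-> ua]] := codeP _ E1; have [b cb [-> ub]] := codeP _ E2.
rewrite indicE mem_set// mul1r /f (bigD1 a)//= (bigD1 b)//= indicE mem_set// mulr1.
rewrite big1 ?addr0; last first.
  move=> b' /eqP b'b; rewrite indicE memNset ?mulr0// => -[_ /= /ub]; exact: b'b.
rewrite big1 ?addr0// => a' /eqP a'a; rewrite big1// => b' _.
by rewrite indicE memNset ?mulr0// => -[/= /ua e _]; exact: a'a e.
Qed.

Local Open Scope ereal_scope.

Let mprod m (a b : code m) : measurable (cell a `*` cell b).
Proof. exact: measurableX. Qed.

Let mu2 m (a b : code m) : (mu \x mu) (cell a `*` cell b) =
  (fine (mu (cell a)) * fine (mu (cell b)))%:E.
Proof.
rewrite product_measure1E// EFinM !fineK//; exact: mucell.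
Qed.

Let int_indic m (a b : code m) :
  (mu \x mu).-integrable setT (fun p => (\1_(cell a `*` cell b) p)%:E).
Proof.
apply/integrableP; split; first by apply/measurable_EFinP; exact: measurable_indic.
under eq_integral do rewrite gee0_abs ?lee_fin//.
by rewrite integral_indic// setIT [X in X < _]mu2 ltry.
Qed.

Let int_term m (a b : code m) :
  (mu \x mu).-integrable setT (fun p => (k (w a) (w b) * \1_(cell a `*` cell b) p)%:E).
Proof.
under eq_fun do rewrite EFinM.
exact: integrableZl.
Qed.

Let f_integral_ge0 m : 0 <= \int[mu \x mu]_p (f m p)%:E.
Proof.
rewrite /f.
under eq_integral do rewrite -sumEFin.
rewrite integral_sum//; last first.
  move=> a; under eq_fun do rewrite -sumEFin.
  by apply: integrable_sum => // b _; exact: int_term.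
under eq_bigr => a _.
  under eq_integral do rewrite -sumEFin.
  rewrite integral_sum//.
  under eq_bigr => b _.
    under eq_integral do rewrite EFinM.
    rewrite integralZl// integral_indic// setIT [X in _ * X]mu2 -EFinM mulrC.
    over.
  rewrite sumEFin; over.
rewrite sumEFin lee_fin.
exact: (kpd (fun a => fine (mu (cell a)))).
Qed.

(* Replacing [k] by its values at the grid points turns the integral into a finite positive
   definite form, weighted by the measures of the grid cells. *)
Lemma positive_definite_integral_ge0 :
  0 <= \int[mu \x mu]_p (\1_(E `*` E) p * k (row p.1) (row p.2))%:E.
Proof.
have mf m : measurable_fun setT (fun p => (f m p)%:E).
  rewrite /f; under eq_fun do rewrite -sumEFin.
  apply: (measurable_int (mu \x mu)).
  apply: integrable_sum => // a _; under eq_fun do rewrite -sumEFin.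
  by apply: integrable_sum => // b _; exact: int_term.
have ff p : f m p @[m --> \oo] --> (\1_(E `*` E) p * k (row p.1) (row p.2))%R.
  rewrite (funext (fE ^~ p)).
  have [[E1 E2]|nE] := pselect ((E `*` E) p); last first.
    rewrite indicE memNset// mul0r.
    by rewrite (_ : (fun _ => _) = cst 0%R) ?[X in _ --> X]mul0r; [exact: cvg_cst|
      apply/funext => m; rewrite mul0r].
  by apply: cvgMr; apply: kcont => //; exact: grid_cvg.
pose g p := (\1_(E `*` E) p * k (row p.1) (row p.2))%R.
have C0 : (0 <= C)%R by apply: le_trans (kC 0%R 0%R).
have mEE : measurable (E `*` E) by exact: measurableX.
have mg : measurable_fun setT (fun p => (g p)%:E).
  apply/measurable_EFinP; apply: (@measurable_fun_cvg _ _ _ _ f) => [m|p _]; last exact: ff.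
  by apply/measurable_EFinP; exact: mf.
have intC : (mu \x mu).-integrable setT (fun p => (C * \1_(E `*` E) p)%:E).
  under eq_fun do rewrite EFinM.
  apply: integrableZl => //; apply/integrableP; split.
    by apply/measurable_EFinP; exact: measurable_indic.
  under eq_integral do rewrite gee0_abs ?lee_fin//.
  rewrite integral_indic// setIT [X in X < _](product_measure1E mu mu mA mA).
  by rewrite lte_mul_pinfty// ge0_fin_numE.
have dom m p : `|(f m p)%:E| <= (C * \1_(E `*` E) p)%:E.
  rewrite lee_fin fE normrM mulrC; apply: ler_pM => //.
  by rewrite ger0_norm ?indicE.
have ffE p : (f m p)%:E @[m --> \oo] --> (g p)%:E.
  by apply: cvg_EFin; [exact: nearW|exact: ff].
have [_ _ cf] := @dominated_convergence _ _ _ (mu \x mu) setT measurableT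
  (fun m p => (f m p)%:E) (fun p => (g p)%:E) (fun p => (C * \1_(E `*` E) p)%:E) mf mg
  (aeW _ (fun p _ => ffE p)) intC
  (aeW _ (fun p m _ => dom m p)).
rewrite -(cvg_lim _ cf)//; apply: lime_ge; first by apply/cvg_ex; eexists; exact: cf.
by apply: nearW => m; exact: f_integral_ge0.
Qed.

End PositiveDefiniteIntegral.

(** * Topology of the space of independent sets *)

Section IndependentSetSpaces.
Variables (V : topologicalType) (adj : rel V) (k : nat).

Lemma mem_points (t : 'I_k -> V) x :
  reflect (exists i, x = t i) (x \in points t).
Proof.
by apply: (iffP (imfsetP _ _ _ _)) => [[i _ ->]|[i ->]]; exists i.
Qed.

Lemma indep_of_tuple_continuous : continuous (@indep_of_tuple V adj k).
Proof. by apply/continuousP. Qed.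

Lemma cvg_set_type (X : topologicalType) (A : set X) (T : Type) (F : set_system T)
    (FF : Filter F) (u : T -> A) (x : A) :
  (val \o u) @ F --> val x -> u @ F --> x.
Proof.
move=> ux B [/= C [[D oD DC] Cx] CB].
have := ux D; rewrite /= => FD.
have : F ((val \o u) @^-1` D).
  by apply: FD; apply: open_nbhs_nbhs; split => //; move: Cx; rewrite -DC.
by move=> h; rewrite /nbhs/=; apply: filterS h => t Dt; apply: CB; rewrite -DC.
Qed.

Lemma cvg_ptws (I : Type) (X : topologicalType) (T : Type) (F : set_system T)
    (FF : Filter F) (u : T -> {ptws I -> X}) (x : {ptws I -> X}) :
  (forall i, u t i @[t --> F] --> x i) -> u @ F --> x.
Proof.
move=> ux; apply/cvg_sup => i B [/= C [[D oD DC] Cx] CB].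
have h : F [set t | D (u t i)].
  by apply: (ux i D); apply: open_nbhs_nbhs; split => //; move: Cx; rewrite -DC.
by rewrite /nbhs/=; apply: filterS h => t Dt; apply: CB; rewrite -DC.
Qed.

(** Convergence is proved for [k]-tuples enumerating the sets and then pushed through the continuous
    map [indep_of_tuple]. If [I] is empty, no tuple of positive length enumerates it, but then the
    sequence is constant. *)
Lemma indep_cvg (W : choiceType) (I : {fset W}) (h_ : nat -> W -> V) (h : W -> V)
    (J_ : nat -> indep adj k) (J : indep adj k) :
  (#|` I| <= k)%N -> (forall i, i \in I -> h_ ^~ i @ \oo --> h i) ->
  (forall m, [fset h_ m i | i in I] = J_ m) -> [fset h i | i in I] = J ->
  J_ @ \oo --> J.
Proof.
move=> Ik hI J_E JE.
have [I0|[i0 i0I]] := fset_0Vmem I.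
  suff -> : J_ = cst J by exact: cvg_cst.
  apply/funext => m; apply: val_inj; rewrite /= -J_E -JE.
  by apply/fsetP => x; apply/imfsetP/imfsetP => -[i /=]; rewrite I0 inE.
(* When [I] has fewer than [k] elements the tuple is padded with copies of [i0], which do not change
   its set of points. *)
pose t (i : 'I_k) := nth i0 (enum_fset I) i.
have tI i : t i \in I.
  have [iI|iI] := ltnP i #|` I|; first exact: mem_nth.
  by rewrite /t nth_default.
have pointsE (g : W -> V) : points (g \o t) = [fset g i | i in I].
  apply/fsetP => x; apply/mem_points/imfsetP => /= [[i ->]|[w wI ->]].
    by exists (t i).
  have wk : (index w (enum_fset I) < k)%N by rewrite (leq_trans _ Ik)// index_mem.
  by exists (Ordinal wk); rewrite /= /t/= nth_index.
have indepE (g : W -> V) (J' : indep adj k) : [fset g i | i in I] = J' ->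
    ((g \o t : {ptws 'I_k -> V}) \in @indep_tuple V adj k).
  by move=> gJ; apply/mem_set; rewrite /indep_tuple/= pointsE gJ; case/andP: (indepP J').
pose T_ m : @indep_tuple V adj k := exist
  (fun t => t \in @indep_tuple V adj k) _ (indepE _ _ (J_E m)).
pose T : @indep_tuple V adj k := exist (fun t => t \in @indep_tuple V adj k) _ (indepE _ _ JE).
have -> : J_ = @indep_of_tuple V adj k \o T_.
  by apply/funext => m; apply: val_inj; rewrite /= pointsE -J_E.
have -> : J = indep_of_tuple T by apply: val_inj; rewrite /= pointsE -JE.
have cT : T_ @ \oo --> T.
  apply: (@cvg_set_type {ptws 'I_k -> V} (@indep_tuple V adj k) _ \oo _ T_ T).
  apply: cvg_ptws => i; exact: hI.
exact: (cvg_comp _ _ cT (@indep_of_tuple_continuous T)).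
Qed.

Lemma compact_set_type (X : topologicalType) (A : set X) :
  compact A -> compact [set: A].
Proof.
move=> cA F PF _.
have FA : ((val : A -> X) @ F) A.
  by rewrite /= nbhs_simpl; apply: filterS filterT => x _; exact: set_valP.
have [p [Ap Fp]] := cA _ (fmap_proper_filter _ PF) FA.
exists (exist _ p (mem_set Ap)); split => // B C FB [/= D [[E oE ED] Dx] DC].
have : ((val : A -> X) @ F) ((val : A -> X) @` B).
  by rewrite /= nbhs_simpl; apply: filterS FB => x Bx; exists x.
move=> /Fp /(_ (open_nbhs_nbhs (conj oE _))) [|y [[x Bx <-] Ex]].
  by move: Dx; rewrite -ED.
by exists x; split => //; apply: DC; rewrite -ED.
Qed.

(** By Tychonoff the independent tuples form a closed subset of a compact space; their continuous
    image, together with the empty set, is everything. *)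
Lemma indep_compact : compact [set: V] -> closed (@indep_tuple V adj k) ->
  compact [set: indep adj k].
Proof.
move=> cV clT.
have cT : compact (@indep_tuple V adj k).
  apply: (@subclosed_compact {ptws 'I_k -> V} _ setT) => //.
  have := @tychonoff 'I_k (fun=> V) (fun=> setT) (fun=> cV).
  by congr compact; apply/seteqP; split.
have cR := continuous_compact (continuous_subspaceT (@indep_of_tuple_continuous))
  (compact_set_type cT).
have := compactU cR (@compact_set1 _ (indep0 adj k)).
congr compact; apply/seteqP; split => // J _.
have [J0|[x0 xJ]] := fset_0Vmem J.
  by right; apply: val_inj.
left; have /andP[iJ Jk] := indepP J.
pose t : {ptws 'I_k -> V} := fun i => nth x0 (enum_fset J) i.
have tJ : points t = J.
  apply/fsetP => x; apply/mem_points/idP => [[i ->]|xJ'].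
    rewrite /t; have [iJ'|iJ'] := ltnP i #|` J|; first exact: mem_nth.
    by rewrite nth_default.
  have xk : (index x (enum_fset J) < k)%N by rewrite (leq_trans _ Jk)// index_mem.
  by exists (Ordinal xk); rewrite /= /t/= nth_index.
have tT : t \in @indep_tuple V adj k by apply/mem_set; rewrite /indep_tuple/= tJ.
by exists (exist _ t tT) => //; apply: val_inj.
Qed.

End IndependentSetSpaces.

(** * Compactness for the graph on the sphere *)

Section SphereGraph.
Variables (R : realType) (n : nat) (theta : R).
Hypothesis theta0pi : 0 <= theta <= pi.
Local Notation S := (@unit_sphere R n).
Local Notation adj := (@sphere_adj R n theta).

Lemma enorm_sphere (x : S) : enorm (val x) = 1.
Proof. exact: (set_valP x). Qed.

Lemma sqr_enormB_sphere (x y : S) : enorm (val x - val y) ^+ 2 = 2 * (1 - dotp (val x) (val y)).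
Proof. by rewrite sqr_enormB !enorm_sphere; ring. Qed.

Lemma dotp_sphere_le1 (x y : S) : dotp (val x) (val y) <= 1.
Proof. by have := dotp_le (val x) (val y); rewrite !enorm_sphere mulr1. Qed.

Lemma dotp_sphere_geN1 (x y : S) : -1 <= dotp (val x) (val y).
Proof.
have := dotp_le (val x) (- val y).
by rewrite enormN !enorm_sphere mulr1 dotpNr lerNl.
Qed.

Lemma dotp_sphere_lt1 (x y : S) : (dotp (val x) (val y) < 1) = (x != y).
Proof.
rewrite lt_def dotp_sphere_le1 andbT; congr (~~ _).
rewrite -(inj_eq val_inj) -subr_eq0 -[RHS]subr_eq0 -[RHS]enorm_eq0.
by rewrite -[RHS]sqrf_eq0 sqr_enormB_sphere mulf_eq0 pnatr_eq0.
Qed.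

(** Since [cos] decreases on [[0, pi]], adjacency becomes a condition on inner products, free of
    [acos] and suited to continuity arguments. *)
Lemma sphere_adjE (x y : S) : adj x y = (cos theta < dotp (val x) (val y) < 1).
Proof.
rewrite /sphere_adj -dotp_sphere_lt1 andbC; congr (_ && _).
have d1 : -1 <= dotp (val x) (val y) <= 1 by rewrite dotp_sphere_geN1 dotp_sphere_le1.
rewrite -[in RHS](acosK (x := dotp (val x) (val y))) ?in_itv//=.
by rewrite ltr_cos ?in_itv//= acos_ge0 ?acos_lepi.
Qed.

Lemma val_sphere_continuous : continuous (val : S -> 'rV[R]_n).
Proof. exact: initial_continuous. Qed.

Lemma sphere_compact : compact [set: S].
Proof.
apply: compact_set_type; apply: bounded_closed_compact.
  exists 1; split; first exact: num_real.
  move=> M M1 x /= x1; rewrite (le_trans _ (ltW M1))//.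
  rewrite -x1 [leLHS]/Num.norm/= mx_normrE; apply/bigmax_leP; split; first exact: enorm_ge0.
  by move=> [i j] _ /=; rewrite (ord1 i); exact: coord_le_enorm.
have -> : S = @enorm R n @^-1` [set 1] by [].
apply: closed_comp => [x _|]; first exact: enorm_continuous.
exact: closed_eq.
Qed.

(** Entries of a tuple may coincide, so non-adjacency reads: inner product at most [cos theta], or
    at least 1. Both conditions are closed. *)
Lemma closed_indep_sphere k : closed (@indep_tuple S adj k).
Proof.
have -> : @indep_tuple S adj k = \bigcap_(ij in [set: 'I_k * 'I_k])
    ((fun t : {ptws 'I_k -> S} => dotp (val (t ij.1)) (val (t ij.2))) @^-1`
      ([set u | u <= cos theta] `|` [set u | 1 <= u])).
  apply/seteqP; split => t /=.
    move=> /independentP it [i j] _ /=.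
    have := it (t i) (t j); rewrite sphere_adjE negb_and -!leNgt => h.
    by apply/orP; apply: h; apply/mem_points; [exists i|exists j].
  move=> it; apply/independentP => x y /mem_points[i ->] /mem_points[j ->].
  by rewrite sphere_adjE negb_and -!leNgt; apply/orP; exact: (it (i, j)).
apply: closed_bigI => -[i j] _ /=.
apply: closed_comp => [t _|]; last by apply: closedU; [exact: closed_le|exact: closed_ge].
have h l : (fun t : {ptws 'I_k -> S} => val (t l)) @ t --> val (t l).
  apply: (cvg_comp (fun t : {ptws 'I_k -> S} => t l) val); last exact: val_sphere_continuous.
  exact: (@proj_continuous 'I_k (fun=> S) l t).
exact: (cvg_dotp (h i) (h j)).
Qed.

(** Compactness of the domain gives the constant that dominates all later integrands. *)
Lemma sphere_kernel_bounded k (K : S * S * indep adj k -> R) : continuous K ->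
  exists C, forall p, `|K p| <= C.
Proof.
move=> cK.
have cT : compact [set: S * S * indep adj k].
  have := compact_setX (compact_setX sphere_compact sphere_compact)
    (indep_compact sphere_compact (@closed_indep_sphere k)).
  by rewrite !setXTT.
have /compact_bounded[M [_ MK]] := continuous_compact (continuous_subspaceT cK) cT.
by exists (M + 1) => p; apply: (MK (M + 1)); [rewrite ltrDl|exists p].
Qed.

End SphereGraph.

(** * Neighbourhoods of packings in Euclidean space *)

Section SpaceGraph.
Variables (R : realType) (n : nat).
Local Notation adj := (@space_adj R n).

Lemma space_independentP (J : {fset 'rV[R]_n}) x y : independent adj J ->
  x \in J -> y \in J -> x != y -> 2 <= enorm (x - y).
Proof.
move=> /independentP iJ xJ yJ xy; have := iJ _ _ xJ yJ.
by rewrite /space_adj enorm_gt0 subr_eq0 xy/= -leNgt.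
Qed.

(* Two points of an independent set in a ball of radius at most 1 coincide, so every set
   close to [J0] is the image of [J0] under a map close to the identity. *)
Lemma indep_space_nbhs k (J0 : indep adj k) (e : R) : 0 < e <= 1 ->
  nbhs J0 [set J : indep adj k | exists2 s : 'rV[R]_n -> 'rV[R]_n,
    [fset s j | j in (J0 : {fset _})] = J & forall j, j \in (J0 : {fset _}) -> enorm (s j - j) < e].
Proof.
move=> /andP[e0 e1].
(* This is the ball of radius [e] about [J0] for the Hausdorff distance; its openness is checked on
   tuples, as the quotient topology demands. *)
pose close (J : indep adj k) :=
  (forall x : J, exists y : J0, enorm (val x - val y) < e) /\
  (forall y : J0, exists x : J, enorm (val x - val y) < e).
have oc : open (close : set (indep adj k)).
  rewrite /open/= /indep_open/= openE => t [h1 h2].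
  have ct i (y : 'rV[R]_n) : enorm (val t i - y) < e ->
      \forall t' \near t, enorm (val t' i - y) < e.
    move=> ty; have : enorm (val t' i - y) @[t' --> t] --> enorm (val t i - y).
      apply: (@cvg_enorm R n _ (nbhs t) _ (fun t' => val t' i - y)).
      apply: (@cvgB _ _ _ (nbhs t) _ (fun t' => val t' i) (fun=> y)); last exact: cvg_cst.
      apply: (cvg_comp val (fun t : {ptws 'I_k -> 'rV[R]_n} => t i)).
        exact: (@initial_continuous (@indep_tuple 'rV[R]_n adj k) {ptws 'I_k ->
          'rV[R]_n} set_val t).
      exact: (@proj_continuous 'I_k (fun=> 'rV[R]_n) i (val t)).
    by move=> /(_ [set u | u < e]); apply; exact: open_nbhs_nbhs.
  have n1 : \forall t' \near t, forall i, exists y : J0, enorm (val t' i - val y) < e.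
    suff h i : \forall t' \near t, exists y : J0, enorm (val t' i - val y) < e.
      exact: (filter_forall (nbhs_filter t) h).
    have ti : val t i \in points (val t) by apply/mem_points; exists i.
    have [y /= ty] := h1 [` ti].
    by near=> t'; exists y; near: t'; exact: ct.
  have n2 : \forall t' \near t, forall y : J0, exists i, enorm (val t' i - val y) < e.
    suff h (y : J0) : \forall t' \near t, exists i, enorm (val t' i - val y) < e.
      exact: (filter_forall (nbhs_filter t) h).
    have [[x xt] /= xy] := h2 y.
    have /mem_points[i xi] := xt; rewrite xi in xy.
    by near=> t'; exists i; near: t'; exact: ct.
  apply: filterS2 n1 n2 => t' g1 g2; split => [[x xt]|y] /=.
    by have /mem_points[i ->] := xt.
  have [i ty] := g2 y.
  have ti : val t' i \in points (val t') by apply/mem_points; exists i.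
  by exists [` ti].
apply: (@filterS _ _ _ close); last first.
  apply: open_nbhs_nbhs; split => //; split => x; exists x; by rewrite subrr enorm0.
move=> J [h1 h2].
pose s (y : 'rV[R]_n) := if insub y is Some y' then val (projT1 (cid (h2 y'))) else y.
have sE (y : J0) : exists2 x : J, s (val y) = val x & enorm (val x - val y) < e.
  by rewrite /s valK; case: cid => x xy /=; exists x.
exists s; last first.
  by move=> j jJ; have [x ->] := sE [` jJ].
apply/fsetP => x; apply/imfsetP/idP => /= [[y yJ ->]|xJ].
  by have [x' -> _] := sE [` yJ]; exact: (valP x').
have [y xy] := h1 [` xJ]; have [z sz zy] := sE y.
exists (val y); first exact: (valP y).
rewrite sz; apply/eqP; apply: contraT => xz; have /andP[iJ _] := indepP J.
have := space_independentP iJ xJ (valP z) xz; rewrite leNgt.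
have := enorm_triangle x (val z) (val y); rewrite (enorm_distC (val y)) => h.
by rewrite (le_lt_trans h)//; move: xy zy => /=; lra.
Unshelve. all: by end_near. Qed.

End SpaceGraph.

(** * The operator B_k *)

Section ImageFset.
Variables (V W : choiceType) (S : {fset V}) (h : V -> W).
Hypothesis h_inj : {in S &, injective h}.

Lemma fpowerset_imfset :
  fpowerset [fset h x | x in S] = [fset [fset h x | x in (J : {fset V})] | J in fpowerset S].
Proof.
apply/fsetP => J'; apply/idP/imfsetP => /= [|[J]]; rewrite !fpowersetE.
  move=> /fsubsetP J'S; exists [fset x in S | h x \in J'].
    by rewrite fpowersetE; apply/fsubsetP => x; rewrite !inE/= => /andP[].
  apply/fsetP => y; apply/idP/imfsetP => /= [yJ'|[x]].
    have /imfsetP[x /= xS yx] := J'S _ yJ'.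
    by exists x => //; rewrite !inE/= xS -yx.
  by rewrite !inE/= => /andP[_ hx] ->.
move=> /fsubsetP JS ->; apply/fsubsetP => y /imfsetP[x /= xJ ->].
by apply/imfsetP; exists x => //=; exact: JS.
Qed.

Lemma imfset_mem (J : {fset V}) x : (J `<=` S)%fset -> x \in S ->
  (h x \in [fset h y | y in J]) = (x \in J).
Proof.
move=> /fsubsetP JS xS; apply/imfsetP/idP => /= [[y yJ /h_inj e]|xJ]; last by exists x.
by rewrite e// JS.
Qed.

Lemma imfset_inj_sub : {in fpowerset S &, injective (fun J : {fset V} => [fset h x | x in J])}.
Proof.
move=> I J; rewrite !fpowersetE => IS JS IJ; apply/fsetP => x.
have [xS|xS] := boolP (x \in S); first by rewrite -(@imfset_mem I)// IJ imfset_mem.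
have nin (L : {fset V}) : (L `<=` S)%fset -> (x \in L) = false.
  by move=> /fsubsetP LS; apply/negbTE; apply: contra xS; exact: LS.
by rewrite !nin.
Qed.

Lemma card_imfset_sub (J : {fset V}) : (J `<=` S)%fset -> #|` [fset h x | x in J]| = #|` J|.
Proof.
by move=> /fsubsetP JS; rewrite card_in_imfset//= => x y xJ yJ; apply: h_inj; exact: JS.
Qed.

End ImageFset.

Section BopTheory.
Variable R : realType.

Lemma insub_indep (V : choiceType) (adj : rel V) k (J : {fset V})
    (iJ : independent adj J && (#|` J| <= k)%N) :
  insub J = Some (Indep iJ : indep adj k).
Proof. by rewrite (insubT (fun A : {fset V} => independent adj A && (#|` A| <= k)%N)). Qed.

(** An injection on [S] matches the triples [(J, x, y)] of the two sums. Independence of both sets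
    puts every [J] and its image into the respective spaces, so the default value in [Bop] never
    shows. *)
Lemma Bop_imfset (V W : choiceType) (adjV : rel V) (adjW : rel W) k
    (T : V * V * indep adjV (k - 2) -> R) (K : W * W * indep adjW (k - 2) -> R)
    (S : {fset V}) (h : V -> W) :
  {in S &, injective h} -> independent adjV S -> independent adjW [fset h x | x in S] ->
  (forall x y (J : indep adjV (k - 2)) (J' : indep adjW (k - 2)),
     x \in S -> y \in S -> ((J : {fset V}) `<=` S)%fset -> [fset h j | j in (J : {fset V})] = J' ->
     T (x, y, J) = K (h x, h y, J')) ->
  Bop T S = Bop K [fset h x | x in S].
Proof.
move=> h_inj iS ihS TK; rewrite /Bop fpowerset_imfset.
rewrite [RHS]big_mkcond big_imfset/=; last exact: imfset_inj_sub.
rewrite [LHS]big_mkcond/= [LHS]big_seq [RHS]big_seq; apply: eq_bigr => J.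
rewrite fpowersetE => JS; rewrite (@card_imfset_sub _ _ S h h_inj)//; case: ifP => // Jk.
rewrite [RHS]big_imfset//= big_seq [RHS]big_seq; apply: eq_bigr => x xS.
rewrite [RHS]big_mkcond [RHS]big_imfset//= [LHS]big_mkcond/= big_seq [RHS]big_seq.
apply: eq_bigr => y yS.
have -> : (([fset h x; h y] `|` [fset h x | x in J])%fset == [fset h x | x in S]) =
    (([fset x; y] `|` J)%fset == S).
  have xyJ : ([fset x; y] `|` J `<=` S)%fset.
    by rewrite fsubUset JS andbT; apply/fsubsetP => z; rewrite !inE => /orP[] /eqP ->.
  rewrite -(inj_in_eq (@imfset_inj_sub _ _ S h h_inj)) ?fpowersetE ?fsubset_refl//.
  congr (_ == _); apply/fsetP => w; apply/idP/imfsetP => /=.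
    rewrite !inE => /orP[/orP[] /eqP ->|/imfsetP[j /= jJ ->]].
    - by exists x; rewrite // !inE eqxx.
    - by exists y; rewrite // !inE eqxx orbT.
    - by exists j; rewrite // !inE jJ orbT.
  move=> [z + ->]; rewrite !inE => /orP[/orP[] /eqP ->|zJ]; rewrite ?eqxx ?orbT//.
  by apply/orP; right; apply/imfsetP; exists z.
case: ifP => // _.
have iJ : independent adjV J && (#|` J| <= k - 2)%N.
  rewrite Jk andbT; apply/independentP => u v uJ vJ.
  by move/independentP : iS; apply; exact: (fsubsetP JS).
have ihJ : independent adjW [fset h x | x in J] && (#|` [fset h x | x in J]| <= k - 2)%N.
  rewrite (@card_imfset_sub _ _ S h h_inj)// Jk andbT; apply/independentP => u v uJ vJ.
  move/independentP : ihS; apply.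
    by move: uJ => /imfsetP[u' /= u'J ->]; apply/imfsetP; exists u' => //=; exact: (fsubsetP JS).
  by move: vJ => /imfsetP[u' /= u'J ->]; apply/imfsetP; exists u' => //=; exact: (fsubsetP JS).
by rewrite (insub_indep iJ) (insub_indep ihJ) /=; exact: TK.
Qed.

Lemma Bop_eq0 (V : choiceType) (adj : rel V) k (T : V * V * indep adj (k - 2) -> R) S :
  (forall x y (J : indep adj (k - 2)), ([fset x; y] `|` J)%fset = S -> T (x, y, J) = 0) ->
  Bop T S = 0.
Proof.
move=> T0; rewrite /Bop big1// => J _; rewrite big1// => x _; rewrite big1// => y /eqP xyJ.
by case: insubP => //= J' _ JE; apply: T0; rewrite JE.
Qed.

Lemma BopD (V : choiceType) (adj : rel V) k (T U : V * V * indep adj (k - 2) -> R) S :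
  Bop (fun p => T p + U p) S = Bop T S + Bop U S.
Proof.
rewrite /Bop -big_split; apply: eq_bigr => J _; rewrite -big_split.
apply: eq_bigr => x _; rewrite -big_split; apply: eq_bigr => y _.
by case: insub => //=; rewrite addr0.
Qed.

(** The definition sums over distinct points, whereas [h] may merge indices, as projection does for
    points on one ray. The weights of indices with a common image are added up. *)
Lemma positive_definite_pullback (V : choiceType) (K : V -> V -> R) (I : choiceType)
    (s : {fset I}) (c : I -> R) (h : I -> V) : positive_definite K ->
  0 <= \sum_(i <- s) \sum_(j <- s) c i * c j * K (h i) (h j).
Proof.
move=> [_ pdK].
pose d v := \sum_(i <- s | h i == v) c i.
have := pdK [fset h i | i in s] d; congr (0 <= _); apply/esym.
rewrite (partition_big_imfset _ h)/=; apply: eq_bigr => u _.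
transitivity (\sum_(i <- s | h i == u) \sum_(v <- [fset h i | i in s]) c i * d v * K u v).
  apply: eq_bigr => i /eqP <-; rewrite (partition_big_imfset _ h)/=.
  apply: eq_bigr => v _; rewrite /d mulr_sumr mulr_suml.
  by apply: eq_bigr => j /eqP <-.
by rewrite exchange_big; apply: eq_bigr => v _; rewrite -!mulr_suml.
Qed.

Lemma positive_definite_diag_ge0 (V : choiceType) (K : V -> V -> R) x :
  positive_definite K -> 0 <= K x x.
Proof.
by move=> [_ /(_ [fset x] (fun=> 1))]; rewrite !big_seq_fset1 !mul1r.
Qed.

(** On a singleton every term is a diagonal value of a positive definite kernel. This later yields
    [0 <= M]. *)
Lemma Bop_singleton_ge0 (V : choiceType) (adj : rel V) k (K : V * V * indep adj (k - 2) -> R) x :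
  (forall J, positive_definite (fun x y => K (x, y, J))) -> 0 <= Bop K [fset x].
Proof.
move=> pdK; rewrite /Bop; apply: sumr_ge0 => J _; rewrite big_seq_fset1.
rewrite big_mkcond big_seq_fset1; case: ifP => // _; case: insub => //= J'.
exact: (positive_definite_diag_ge0 x (pdK J')).
Qed.

Definition empty_indicator (V : choiceType) (adj : rel V) k (p : V * V * indep adj k) : R :=
  ((p.2 : {fset V}) == fset0)%:R.

Lemma Bop_empty_indicator (V : choiceType) (adj : rel V) k (S : {fset V}) :
  Bop (@empty_indicator V adj (k - 2)) S =
  \sum_(x <- S) \sum_(y <- S | [fset x; y] == S) 1.
Proof.
rewrite /Bop big_mkcond (bigD1_seq fset0)/=; last 2 first.
- by rewrite fpowersetE fsub0set.
- exact: fset_uniq.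
rewrite [X in _ + X]big1 ?addr0; last first.
  move=> J J0; case: ifP => // _; rewrite big1// => x _; rewrite big1// => y _.
  by case: insubP => //= J' _; rewrite /empty_indicator/= => ->; rewrite (negbTE J0).
apply: eq_bigr => x _; apply: eq_big => y; first by rewrite fsetU0.
rewrite (insub_indep (indep0_subproof adj (k - 2)))/= /empty_indicator/=.
done.
Qed.

Lemma Bop_empty_indicator1 (V : choiceType) (adj : rel V) k (x : V) :
  Bop (@empty_indicator V adj (k - 2)) [fset x] = 1.
Proof.
by rewrite Bop_empty_indicator big_seq_fset1 big_mkcond big_seq_fset1 fsetUid eqxx.
Qed.

(** The value 2 counts the ordered pairs [(x, y)] and [(y, x)]. *)
Lemma Bop_empty_indicator2 (V : choiceType) (adj : rel V) k (x y : V) : x != y ->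
  Bop (@empty_indicator V adj (k - 2)) [fset x; y] = 2.
Proof.
move=> xy; rewrite Bop_empty_indicator.
have e1 (z : V) : ([fset z; z] == [fset x; y]) = false.
  apply/negbTE; apply: contra xy => /eqP/fsetP e.
  have := e x; have := e y; rewrite !inE !eqxx !orbb orbT/= => /eqP -> /eqP ->.
  exact: eqxx.
rewrite !big_fsetU1 ?inE// !big_seq_fset1 !big_mkcond/=.
rewrite !big_fsetU1 ?inE// !big_seq_fset1 !e1 eqxx.
by rewrite big_mkcond/= big_fsetU1 ?inE//= big_seq_fset1 e1 (fsetUC [fset y]) eqxx addr0 add0r.
Qed.

Lemma Bop_empty_indicator3 (V : choiceType) (adj : rel V) k (S : {fset V}) :
  (3 <= #|` S|)%N -> Bop (@empty_indicator V adj (k - 2)) S = 0.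
Proof.
move=> S3; rewrite Bop_empty_indicator big1// => x _; rewrite big1// => y /eqP e.
by move: S3; rewrite -e cardfs2; case: eqP.
Qed.

End BopTheory.

(** * Radial projection *)

Section HalfAngle.
Variables (R : realType) (theta : R).
Hypothesis theta_bound : pi / 3 <= theta <= pi.

(* [c = cos (pi / 3)] satisfies [4 c ^ 3 - 3 c = -1], that is [(c + 1) (2 c - 1) ^ 2 = 0]. *)
Lemma cos_pi3 : cos (pi / 3 : R) = 2^-1.
Proof.
have p0 := pi_gt0 R.
(* This excludes the root -1 of the cubic. *)
have c1 : -1 < cos (pi / 3 : R).
  by rewrite -(@cospi R) ltr_cos ?in_itv/=; lra.
have e : cos (pi : R) = 4 * cos (pi / 3) ^+ 3 - 3 * cos (pi / 3).
  rewrite -{1}(_ : pi / 3 *+ 2 + pi / 3 = pi); last by field.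
  rewrite cosD cos_mulr2n sin_mulr2n.
  have := sin2cos2 (pi / 3 : R); move: (sin _) (cos _) => s c h.
  have -> : (c * s) *+ 2 * s = 2 * c * (1 - c ^+ 2) by rewrite -h; ring.
  by ring.
move: e c1; rewrite cospi; set c := cos _ => e c1.
have : (c + 1) * (2 * c - 1) ^+ 2 = 0 by move: e; lra.
move/eqP; rewrite mulf_eq0 sqrf_eq0 => /orP[/eqP|/eqP]; lra.
Qed.

Lemma angle_bound : 0 <= theta <= pi.
Proof. by move: (pi_gt0 R) (andP theta_bound) => p0 [t1 t2]; apply/andP; split; lra. Qed.

Lemma cos_half_angle : cos theta = 1 - 2 * sin (theta / 2) ^+ 2.
Proof.
rewrite -{1}(_ : theta / 2 *+ 2 = theta); last by field.
by rewrite cos_mulr2n cos2sin2; ring.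
Qed.

Lemma sin_half_angle_gt0 : 0 < sin (theta / 2).
Proof.
have p0 := pi_gt0 R; move/andP: theta_bound => [t1 t2].
apply: sin_gt0_pi; lra.
Qed.

(** The radius is at most 2: [pi / 3 <= theta] gives [cos theta <= 1 / 2], and the half-angle
    formula converts this. *)
Lemma sin_half_angle_sqr_ge : 1 <= 4 * sin (theta / 2) ^+ 2.
Proof.
have p0 := pi_gt0 R; move/andP: theta_bound => [t1 t2].
have : cos theta <= cos (pi / 3).
  have t3 : (pi / 3 : R) \in `[0, pi] by rewrite in_itv/=; lra.
  have t : theta \in `[0, pi] by rewrite in_itv/=; lra.
  by rewrite leNgt ltr_cos// -leNgt; lra.
by rewrite cos_half_angle cos_pi3; lra.
Qed.

(* With [p = s|u|] and [q = s|v|] in [0, 1] and [4 s^2 >= 1], the law of cosines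
   reduces the claim to [(p - q)^2 <= 1 - p q]. *)
Lemma dotp_le_cos n (u v : 'rV[R]_n) :
  enorm u < (sin (theta / 2))^-1 -> enorm v < (sin (theta / 2))^-1 ->
  2 <= enorm (u - v) -> dotp u v <= enorm u * enorm v * cos theta.
Proof.
have s0 := sin_half_angle_gt0; have s4 := sin_half_angle_sqr_ge.
rewrite cos_half_angle => us vs uv.
have : 2 ^+ 2 <= enorm (u - v) ^+ 2 by rewrite ler_pXn2r ?nnegrE ?enorm_ge0.
rewrite sqr_enormB.
have := enorm_ge0 u; have := enorm_ge0 v; move: us vs.
set s := sin _ in s0 s4 *; move: (enorm u) (enorm v) (dotp u v) => a b d as1 bs1 b0 a0 dist.
have {}as1 : s * a < 1 by rewrite mulrC -ltr_pdivlMr// div1r.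
have {}bs1 : s * b < 1 by rewrite mulrC -ltr_pdivlMr// div1r.
have p0 : 0 <= s * a by rewrite mulr_ge0// ltW.
have q0 : 0 <= s * b by rewrite mulr_ge0// ltW.
have h : (s * a - s * b) ^+ 2 <= 4 * s ^+ 2 * (1 - s * a * (s * b)).
  move: p0 q0 as1 bs1; move: (s * a) (s * b) => p q p0 q0 p1 q1.
  apply: (@le_trans _ _ (1 - p * q)); last first.
    by rewrite ler_peMl// subr_ge0 mulr_ile1// ltW.
  have := mulr_ile1 p0 p0 (ltW p1) (ltW p1); have := mulr_ile1 q0 q0 (ltW q1) (ltW q1).
  (* For [q <= p] one has [p^2 - p q + q^2 = p^2 - q (p - q) <= 1]; the other case is symmetric. *)
  case/orP: (le_total q p) => pq.
    by have : 0 <= q * (p - q) by [rewrite mulr_ge0// subr_ge0]; lra.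
  by have : 0 <= p * (q - p) by [rewrite mulr_ge0// subr_ge0]; lra.
have : s ^+ 2 * (a ^+ 2 + b ^+ 2 - 2 * (a * b * (1 - 2 * s ^+ 2)) - 2 ^+ 2) <= 0.
  by move: h; rewrite -subr_le0; congr (_ <= 0); ring.
rewrite pmulr_rle0 ?exprn_gt0//; lra.
Qed.

End HalfAngle.

Section RadialProjection.
Variables (R : realType) (n : nat).
Hypothesis n_gt0 : (0 < n)%N.
Local Notation S := (@unit_sphere R n).

Let basis_in_sphere : delta_mx 0 (Ordinal n_gt0) \in S.
Proof.
apply/mem_set; rewrite /unit_sphere/= /enorm /dotp (bigD1 (Ordinal n_gt0))//= big1.
  by rewrite !mxE !eqxx mulr1 addr0 sqrtr1.
by move=> i /negbTE iN; rewrite !mxE iN andbF mulr0.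
Qed.

(** At the origin the value is the default, a basis vector, which exists because [n > 0]. A total
    map lets kernels be pulled back to all rows. *)
Definition proj_sphere (u : 'rV[R]_n) : S :=
  insubd (exist (fun x => x \in S) _ basis_in_sphere) ((enorm u)^-1 *: u).

Lemma val_proj_sphere u : u != 0 -> val (proj_sphere u) = (enorm u)^-1 *: u.
Proof.
rewrite -enorm_gt0 => u0; rewrite /proj_sphere val_insubd ifT//; apply/mem_set.
by rewrite /unit_sphere/= enormZ gtr0_norm ?invr_gt0// mulVf// gt_eqF.
Qed.

Lemma cvg_proj_sphere (u_ : nat -> 'rV[R]_n) (u : 'rV[R]_n) : u != 0 ->
  u_ @ \oo --> u -> (proj_sphere \o u_) @ \oo --> proj_sphere u.
Proof.
move=> u0 uu; apply: cvg_set_type; rewrite val_proj_sphere//.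
have cu : (enorm (u_ m))^-1 *: u_ m @[m --> \oo] --> (enorm u)^-1 *: u.
  by apply: cvgZ => //; apply: cvgV; [rewrite enorm_eq0|exact: cvg_enorm].
apply: cvg_trans cu; apply: near_eq_cvg.
have : \forall m \near \oo, 0 < enorm (u_ m).
  by apply: (cvgr_gt _ (cvg_enorm uu)); rewrite enorm_gt0.
by apply: filterS => m; rewrite enorm_gt0 => um /=; rewrite val_proj_sphere.
Qed.

Lemma dotp_proj_sphere u v : u != 0 -> v != 0 ->
  dotp (val (proj_sphere u)) (val (proj_sphere v)) = dotp u v / (enorm u * enorm v).
Proof.
by move=> u0 v0; rewrite !val_proj_sphere// dotpZl dotpZr invfM mulrA mulrC.
Qed.

Variables (theta : R) (theta_bound : pi / 3 <= theta <= pi).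
Local Notation radius := (sin (theta / 2))^-1.
Local Notation sadj := (@sphere_adj R n theta).
Local Notation eadj := (@space_adj R n).

Definition in_ball (u : 'rV[R]_n) : bool := 0 < enorm u < radius.

Let theta0pi : 0 <= theta <= pi.
Proof. exact: angle_bound. Qed.

Lemma proj_sphere_apart u v : in_ball u -> in_ball v -> 2 <= enorm (u - v) ->
  dotp (val (proj_sphere u)) (val (proj_sphere v)) <= cos theta.
Proof.
move=> /andP[u0 ur] /andP[v0 vr] uv.
rewrite dotp_proj_sphere -?enorm_gt0// ler_pdivrMr ?mulr_gt0// mulrC.
exact: dotp_le_cos.
Qed.

Lemma proj_sphere_independent (J : {fset 'rV[R]_n}) : independent eadj J ->
  {in J, forall u, in_ball u} -> independent sadj [fset proj_sphere u | u in J].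
Proof.
move=> iJ JA; apply/independentP => _ _ /imfsetP[u /= uJ ->] /imfsetP[v /= vJ ->].
rewrite sphere_adjE//; have [->|uv] := eqVneq u v.
  by rewrite dotp_sphere_lt1 eqxx andbF.
by rewrite ltNge proj_sphere_apart ?JA// (space_independentP iJ).
Qed.

(** Two distinct points with the same projection would have projected inner product 1, at most
    [cos theta]; but [theta > 0]. *)
Lemma proj_sphere_inj (J : {fset 'rV[R]_n}) : independent eadj J ->
  {in J, forall u, in_ball u} -> {in J &, injective proj_sphere}.
Proof.
move=> iJ JA u v uJ vJ uv; apply/eqP; apply: contraT => neq.
have := proj_sphere_apart (JA _ uJ) (JA _ vJ) (space_independentP iJ uJ vJ neq).
rewrite uv -sqr_enorm enorm_sphere expr1n leNgt -(cos0 R) ltr_cos ?in_itv/= ?lexx ?pi_ge0//.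
by move: (pi_gt0 R) (andP theta_bound) => p0 [t1 t2]; rewrite (lt_le_trans _ t1)// divr_gt0.
Qed.

(** The projection of a set not contained in the ball may fail to be independent or have a
    meaningless point; [lift_kernel] tests membership in the ball before using the value. *)
Definition proj_indep k (J : indep eadj k) : indep sadj k :=
  insubd (indep0 sadj k) [fset proj_sphere u | u in (J : {fset _})].

Lemma val_proj_indep k (J : indep eadj k) : {in (J : {fset _}), forall u, in_ball u} ->
  proj_indep J = [fset proj_sphere u | u in (J : {fset _})] :> {fset S}.
Proof.
move=> JA; have /andP[iJ Jk] := indepP J; rewrite /proj_indep val_insubd ifT//.
by rewrite proj_sphere_independent// (leq_trans (leq_imfset_card _ _ _)).
Qed.

Lemma proj_indep0 k : proj_indep (indep0 eadj k) = indep0 sadj k.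
Proof. by apply: val_inj; rewrite /= val_proj_indep//= imfset0. Qed.

Section Lift.
Variables (k : nat) (K : S * S * indep sadj k -> R).
Hypothesis K_cont : continuous K.

Definition ball_points (p : 'rV[R]_n * 'rV[R]_n * indep eadj k) : seq 'rV[R]_n :=
  [:: p.1.1, p.1.2 & enum_fset p.2].

Definition lift_kernel (p : 'rV[R]_n * 'rV[R]_n * indep eadj k) : R :=
  if all in_ball (ball_points p)
  then K (proj_sphere p.1.1, proj_sphere p.1.2, proj_indep p.2) else 0.

(** Away from the centre and the boundary sphere, membership in the ball is eventually constant
    along the sequence: either some point stays outside and the values vanish, or all stay inside
    and continuity of [K] applies. The maps [s_ m] track the individual points of the moving
    sets. *)
Lemma lift_kernel_cvg (x_ y_ : nat -> 'rV[R]_n) (J_ : nat -> indep eadj k)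
    (s_ : nat -> 'rV[R]_n -> 'rV[R]_n) (x y : 'rV[R]_n) (J : indep eadj k) :
  x_ @ \oo --> x -> y_ @ \oo --> y ->
  (forall m, [fset s_ m j | j in (J : {fset _})] = J_ m) ->
  (forall j, j \in (J : {fset _}) -> s_ ^~ j @ \oo --> j) ->
  (forall u, u \in ball_points (x, y, J) -> enorm u <> 0 /\ enorm u <> radius) ->
  lift_kernel (x_ m, y_ m, J_ m) @[m --> \oo] --> lift_kernel (x, y, J).
Proof.
move=> xx yy JE ss bd.
have near_in (u_ : nat -> 'rV[R]_n) (u : 'rV[R]_n) : u_ @ \oo --> u -> in_ball u ->
    \forall m \near \oo, in_ball (u_ m).
  move=> /cvg_enorm uu /andP[u0 ur]; near=> m; apply/andP; split.
    by near: m; exact: (cvgr_gt _ uu).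
  by near: m; exact: (cvgr_lt _ uu).
(* By [bd], a limit point outside the ball lies strictly beyond the radius, an open condition. *)
have near_out (u_ : nat -> 'rV[R]_n) (u : 'rV[R]_n) : u_ @ \oo --> u ->
  u \in ball_points (x, y, J) ->
    ~~ in_ball u -> \forall m \near \oo, ~~ in_ball (u_ m).
  move=> uu /bd[u0 ur]; rewrite negb_and -leNgt -leNgt => /orP[|ru].
    by rewrite le_eqVlt ltNge enorm_ge0 orbF => /eqP.
  have {}ru : radius < enorm u by rewrite lt_def ru andbT; apply/eqP.
  near=> m; rewrite negb_and -!leNgt; apply/orP; right; apply/ltW.
  by near: m; exact: (cvgr_gt _ (cvg_enorm uu)).
have zero (u_ : nat -> 'rV[R]_n) (u : 'rV[R]_n) : u_ @ \oo --> u -> u \in ball_points (x, y, J) ->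
    ~~ in_ball u -> (forall m, u_ m \in ball_points (x_ m, y_ m, J_ m)) ->
    lift_kernel (x_ m, y_ m, J_ m) @[m --> \oo] --> lift_kernel (x, y, J).
  move=> uu uB uN uBm; rewrite [X in _ --> X]/lift_kernel ifN; last first.
    by apply/negP => /allP/(_ _ uB); exact/negP.
  apply: (@cvg_trans _ ((fun=> 0 : R) @ \oo)); last exact: cvg_cst.
  apply: near_eq_cvg.
  near=> m; have um : ~~ in_ball (u_ m) by near: m; exact: near_out uu uB uN.
  by rewrite /cst /lift_kernel ifN//; apply/negP => /allP/(_ _ (uBm m)); exact/negP.
have [okx|/(zero x_)] := boolP (in_ball x); last first.
  by apply=> // [|m]; rewrite inE eqxx.
have [oky|/(zero y_)] := boolP (in_ball y); last first.
  by apply=> // [|m]; rewrite !inE eqxx orbT.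
have [okJ|/allPn[j jJ jN]] := boolP (all in_ball (enum_fset J)); last first.
  apply: (zero (s_ ^~ j) j) => // [||m]; first exact: ss.
    by rewrite !inE jJ !orbT.
  rewrite !inE; apply/orP; right; apply/orP; right.
  by change (s_ m j \in (J_ m : {fset _})); rewrite -JE; apply/imfsetP; exists j.
have okJP : {in (J : {fset _}), forall u, in_ball u} by exact/allP.
have nearJ : \forall m \near \oo, forall j : (J : {fset _}), in_ball (s_ m (val j)).
  suff h (j : (J : {fset _})) : \forall m \near \oo, in_ball (s_ m (val j)).
    exact: (filter_forall _ h).
  by apply: near_in (ss _ (valP j)) (okJP _ (valP j)).
have okm : \forall m \near \oo, all in_ball (ball_points (x_ m, y_ m, J_ m)).
  near=> m; rewrite /=; apply/and3P; split.
  - by near: m; exact: near_in okx.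
  - by near: m; exact: near_in oky.
  - apply/allP => u; change (u \in (J_ m : {fset _}) -> in_ball u).
    rewrite -JE => /imfsetP[j /= jJ ->].
    have : forall j : (J : {fset _}), in_ball (s_ m (val j)) by near: m.
    by move=> /(_ [` jJ]).
(* Shifting by [N] discards the indices where a point lies outside the ball and the formula through
   [K] fails. *)
have [N _ okN] := okm.
rewrite -(cvg_shiftn N (fun m => lift_kernel (x_ m, y_ m, J_ m))).
have -> : lift_kernel (x, y, J) = K (proj_sphere x, proj_sphere y, proj_indep J).
  by rewrite /lift_kernel/= okx oky okJ.
have -> : (fun m => lift_kernel (x_ (m + N)%N, y_ (m + N)%N, J_ (m + N)%N)) =
    K \o (fun m => (proj_sphere (x_ (m + N)%N), proj_sphere (y_ (m + N)%N),
       proj_indep (J_ (m + N)%N))).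
  by apply/funext => m; rewrite /lift_kernel ifT//; apply: okN; exact: leq_addl.
have nz u : in_ball u -> u != 0 by move=> /andP[]; rewrite enorm_gt0.
have cx : proj_sphere (x_ (m + N)%N) @[m --> \oo] --> proj_sphere x.
  apply: (cvg_proj_sphere (u_ := fun m => x_ (m + N)%N)); first exact: nz.
  by rewrite (cvg_shiftn N).
have cy : proj_sphere (y_ (m + N)%N) @[m --> \oo] --> proj_sphere y.
  apply: (cvg_proj_sphere (u_ := fun m => y_ (m + N)%N)); first exact: nz.
  by rewrite (cvg_shiftn N).
have cJ : proj_indep (J_ (m + N)%N) @[m --> \oo] --> proj_indep J.
  apply: (@indep_cvg _ _ _ _ (J : {fset _}) (fun m j => proj_sphere (s_ (m + N)%N j)) proj_sphere).
  - by have /andP[] := indepP J.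
  - move=> j jJ; apply: (cvg_proj_sphere (u_ := fun m => s_ (m + N)%N j)).
      by apply: nz; exact: okJP.
    by rewrite (cvg_shiftn N (s_ ^~ j)); exact: ss.
  - move=> m; rewrite val_proj_indep => [|u uJ]; last first.
      have := okN (m + N)%N (leq_addl _ _); rewrite /= => /and3P[_ _ /allP]; exact.
    by rewrite -JE -imfset_comp.
  - by rewrite val_proj_indep.
have cK := @K_cont (proj_sphere x, proj_sphere y, proj_indep J).
exact: (cvg_comp _ K (cvg_pair (cvg_pair cx cy) cJ) cK).
Unshelve. all: by end_near. Qed.

End Lift.
End RadialProjection.

(** * Averaging over translations *)

(** Dominated convergence handles sequences only. A countable family of neighbourhoods suffices,
    whether or not it is a base: were continuity to fail, each [U m] would contain a bad point, and
    these form a sequence contradicting the hypothesis. *)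
Lemma cvg_seq_nbhs (T : topologicalType) (R : realType) (f : T -> R) (p : T)
    (U : nat -> set T) : (forall m, nbhs p (U m)) ->
  (forall u : nat -> T, (forall m, U m (u m)) -> (f \o u) @ \oo --> f p) ->
  f @ p --> f p.
Proof.
move=> Up fU; apply/cvgrPdist_lt => e e0; apply: contrapT => H.
have ex m : exists q, U m q /\ e <= `|f p - f q|.
  apply: contrapT => nq; apply: H; near=> q.
  rewrite ltNge; apply/negP => h; apply: nq; exists q; split => //.
  by near: q; exact: Up.
pose u m := projT1 (cid (ex m)).
have uP m : U m (u m) /\ e <= `|f p - f (u m)| := projT2 (cid (ex m)).
have /cvgrPdist_lt/(_ e e0)[N _ /(_ N (leqnn N))] := fU u (fun m => (uP m).1).
by rewrite /= ltNge (uP N).2.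
Unshelve. all: by end_near. Qed.

Lemma Rintegral_sum d (T : measurableType d) (R : realType)
    (mu : {measure set T -> \bar R}) (I : Type) (s : seq I) (P : pred I) (g : I -> T -> R) :
  (forall i, mu.-integrable setT (EFin \o g i)) ->
  \int[mu]_t (\sum_(i <- s | P i) g i t)%R = (\sum_(i <- s | P i) \int[mu]_t g i t)%R.
Proof.
move=> ig; elim: s => [|i s IH].
  rewrite big_nil; under eq_Rintegral do rewrite big_nil.
  by rewrite /Rintegral integral0.
rewrite big_cons -IH; case: ifP => Pi.
  rewrite -RintegralD//; first by apply: eq_Rintegral => t _; rewrite big_cons Pi.
  rewrite (_ : _ \o _ = fun t => \sum_(j <- s | P j) (g j t)%:E)%E;
    first by apply: integrable_sum => // j _; exact: ig.
  by apply/funext => t; rewrite /= sumEFin.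
by apply: eq_Rintegral => t _; rewrite big_cons Pi.
Qed.

Section Average.
Variables (R : realType) (n : nat) (n_gt0 : (0 < n)%N) (theta : R).
Hypothesis theta_bound : pi / 3 <= theta <= pi.
Local Notation S := (@unit_sphere R n).
Local Notation sadj := (@sphere_adj R n theta).
Local Notation eadj := (@space_adj R n).
Local Notation radius := (sin (theta / 2))^-1.
Local Notation mR := (measurableTypeR R).
Local Notation mu := (lebesgue_tuple R n).
Local Notation row := (@row_of_tuple R n).
Variables (k : nat) (K : S * S * indep sadj k -> R) (C : R).
Hypothesis K_cont : continuous K.
Hypothesis K_bound : forall p, `|K p| <= C.
Local Notation point := ('rV[R]_n * 'rV[R]_n * indep eadj k)%type.
Local Notation lift := (lift_kernel n_gt0 K).

Definition translate_point (p : point) (z : 'rV[R]_n) : point :=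
  (p.1.1 + z, p.1.2 + z, translate p.2 z).

Lemma translate_pointD p z w : translate_point (translate_point p z) w = translate_point p (z + w).
Proof.
rewrite /translate_point/= !addrA; congr (_, _, _); apply: val_inj; rewrite /=.
apply/fsetP => x; apply/imfsetP/imfsetP => /= -[y].
  by move=> /imfsetP[y' /= y'J ->] ->; exists y' => //; rewrite addrA.
by move=> yJ ->; exists (y + z); rewrite ?addrA//; apply/imfsetP; exists y.
Qed.

Lemma in_ball_translate p z : all (in_ball theta) (ball_points (translate_point p z)) =
  all (fun u => in_ball theta (u + z)) (ball_points p).
Proof.
rewrite /ball_points/=; congr [&& _, _ & _]; apply/allP/allP => h u uJ.
  by apply: h; apply/imfsetP; exists u.
by move: uJ => /imfsetP[v /= vJ ->]; exact: h.
Qed.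

Let C0 : 0 <= C.
Proof.
apply: le_trans (K_bound (proj_sphere n_gt0 0, proj_sphere n_gt0 0, indep0 sadj k)).
exact: normr_ge0.
Qed.

Lemma lift_bound p : `|lift p| <= C.
Proof. by rewrite /lift_kernel; case: ifP => _; rewrite ?normr0. Qed.

(** If the first point stays in the ball, then [enorm (row t) < radius + enorm p.1.1]. The free
    bound [b] allows one majorant for a whole sequence of [p]. *)
Lemma lift_translate_bound p (b : R) (t : n.-tuple mR) : radius + enorm p.1.1 <= b ->
  `|lift (translate_point p (row t))| <= C * \1_[set t : n.-tuple mR | enorm (row t) <= b] t.
Proof.
move=> pb; have [tb|tb] := leP (enorm (row t)) b.
  by rewrite indicE mem_set// mulr1 lift_bound.
rewrite indicE memNset ?mulr0/=; last by apply/negP; rewrite -ltNge.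
rewrite /lift_kernel ifN ?normr0// in_ball_translate /= negb_and; apply/orP; left.
rewrite /in_ball negb_and -leNgt -[~~ (_ < radius)]leNgt; apply/orP; right.
have := enormD (p.1.1 + row t) (- p.1.1); rewrite addrAC subrr add0r enormN.
by move=> h; lra.
Qed.

(** The integrand vanishes off the set [D] of translations that keep all points in the ball, and at
    points of [D] it is sequentially continuous. *)
Lemma measurable_lift_translate p :
  measurable_fun setT (fun t : n.-tuple mR => lift (translate_point p (row t))).
Proof.
pose D := [set t : n.-tuple mR | all (fun u => in_ball theta (u + row t)) (ball_points p)].
have mD : measurable D.
  rewrite /D; elim: (ball_points p) => [|u s IH] /=.
    by rewrite (_ : [set _ | _] = setT)//; apply/seteqP; split.
  rewrite (_ : [set _ | _] = [set t : n.-tuple mR | in_ball theta (u + row t)] `&`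
    [set t | all (fun u => in_ball theta (u + row t)) s]); last first.
    by apply/seteqP; split => t /= /andP.
  apply: measurableI => //.
  have := measurable_coord_enorm (measurable_translate u) measurableT
    (measurable_itv `]0, radius[%R).
  rewrite setTI; congr (measurable _); apply/seteqP; split => t /=; by rewrite in_itv.
rewrite (_ : (fun _ => _) = (fun t => lift (translate_point p (row t))) \_ D); last first.
  apply/funext => t; rewrite patchE; case: ifPn => //.
  move=> /negP tD; rewrite /lift_kernel ifN// in_ball_translate; apply/negP => h.
  by apply: tD; exact/mem_set.
apply/(measurable_restrictT _ mD).
have := @measurable_fun_seq_continuous R n _ (n.-tuple mR) D row
  (fun z => lift (translate_point p z))
  (@measurable_row R n).
apply; move=> t Dt u ut; rewrite /comp /translate_point.
(* The set translated by [u m] is the image of the set translated by [row t] under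
   [q => q - row t + u m]. *)
apply: (@lift_kernel_cvg _ _ _ _ theta_bound _ _ K_cont (fun m => p.1.1 + u m)
  (fun m => p.1.2 + u m)
  (fun m => translate p.2 (u m)) (fun m q => q - row t + u m)) => //.
- by apply: cvgD => //; exact: cvg_cst.
- by apply: cvgD => //; exact: cvg_cst.
- move=> m; apply/fsetP => x; apply/imfsetP/imfsetP => /= -[y].
    by move=> /imfsetP[z /= zJ ->] ->; exists z => //; rewrite addrK.
  move=> yJ ->; exists (y + row t); rewrite ?addrK//; apply/imfsetP.
  by exists y.
- move=> j _.
  have h : (fun m => j - row t + u m) @ \oo --> j - row t + row t.
    by apply: cvgD => //; exact: cvg_cst.
  by rewrite subrK in h.
- have /allP h : all (in_ball theta) (ball_points (translate_point p (row t))) by rewrite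
  in_ball_translate; exact: Dt.
  move=> q /h /andP[q0 qr]; split; apply/eqP; first by rewrite gt_eqF.
  by rewrite lt_eqF.
Qed.

Lemma integrable_enorm_le (b : R) :
  mu.-integrable setT (fun t : n.-tuple mR =>
    (C * \1_[set t : n.-tuple mR | enorm (row t) <= b] t)%:E).
Proof.
have mb := @measurable_enorm_le R n b.
under eq_fun do rewrite EFinM; apply: integrableZl => //.
apply/integrableP; split; first by apply/measurable_EFinP; exact: measurable_indic.
under eq_integral do rewrite gee0_abs ?lee_fin//.
by rewrite integral_indic// setIT; exact: enorm_le_finite.
Qed.

Lemma integrable_lift_translate p :
  mu.-integrable setT (fun t : n.-tuple mR => (lift (translate_point p (row t)))%:E).
Proof.
apply: (le_integrable measurableT _ _ (integrable_enorm_le (radius + enorm p.1.1))).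
  by apply/measurable_EFinP; exact: measurable_lift_translate.
move=> t _; rewrite lee_fin (le_trans (lift_translate_bound t (lexx _)))//.
exact: ler_norm.
Qed.

Definition average_kernel (p : point) : R := \int[mu]_t lift (translate_point p (row t)).

Lemma average_kernel_translate p z : average_kernel (translate_point p z) = average_kernel p.
Proof.
rewrite /average_kernel /Rintegral; congr fine.
rewrite -[RHS](integral_translate z (g := fun w => (lift (translate_point p w))%:E)).
- by apply: eq_integral => t _; rewrite translate_pointD.
- by apply/measurable_EFinP; exact: measurable_lift_translate.
- exact: integrable_lift_translate.
Qed.

(** The neighbourhoods [U m] provide sequences with explicit rates. Along each of them the
    integrands converge except for the translations that put a point of [p0] on the centre or the
    boundary sphere. *)
Lemma average_kernel_continuous : continuous average_kernel.
Proof.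
suff h (p0 : point) : {for p0, continuous average_kernel} by move=> p; exact: h.
(* The radii are at most 1, as [indep_space_nbhs] requires. *)
pose e (m : nat) : R := m.+1%:R^-1.
have e0 m : 0 < e m by rewrite invr_gt0 ltr0n.
have e1 m : e m <= 1 by rewrite invf_le1 ?ltr0n// ler1n.
have ecvg : e @ \oo --> (0 : R) by exact: cvg_harmonic.
pose U m := [set p : point | [/\ enorm (p.1.1 - p0.1.1) < e m,
  enorm (p.1.2 - p0.1.2) < e m & exists2 s : 'rV[R]_n -> 'rV[R]_n,
    [fset s j | j in (p0.2 : {fset _})] = p.2 &
    forall j, j \in (p0.2 : {fset _}) -> enorm (s j - j) < e m]].
have small (u : nat -> 'rV[R]_n) a : (forall m, enorm (u m - a) < e m) -> u @ \oo --> a.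
  move=> ua; apply: cvg_row => i; apply/cvgrPdist_lt => d d0.
  near=> m; rewrite distrC; have := coord_le_enorm (u m - a) i; rewrite !mxE => h.
  rewrite (le_lt_trans h)// (lt_trans (ua m))//.
  by near: m; exact: (cvgr_lt _ ecvg).
have near_small m (a : 'rV[R]_n) : \forall x \near a, enorm (x - a) < e m.
  have : enorm (x - a) @[x --> a] --> enorm (a - a).
    apply: (@cvg_enorm R n _ (nbhs a) _ (fun x => x - a)).
    by apply: cvgB; [exact: cvg_id|exact: cvg_cst].
  by rewrite subrr enorm0 => h; exact: (cvgr_lt _ h).
apply: (@cvg_seq_nbhs _ _ _ _ U) => [m|u uU].
  exists ([set x | enorm (x.1 - p0.1.1) < e m /\ enorm (x.2 - p0.1.2) < e m],
    [set J : indep eadj k | exists2 s : 'rV[R]_n -> 'rV[R]_n,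
    [fset s j | j in (p0.2 : {fset _})] = J &
    forall j, j \in (p0.2 : {fset _}) -> enorm (s j - j) < e m]).
    split; last by apply: indep_space_nbhs; rewrite e0 e1.
    exists ([set x | enorm (x - p0.1.1) < e m], [set x | enorm (x - p0.1.2) < e m]) => //=.
      by split; exact: near_small.
  by move=> [[x y] J] [[/= xe ye] JU]; split.
(* One map per index is chosen, naming the points of [(u m).2] by those of [p0.2]. *)
have [s_ sJ se] : exists2 s_ : nat -> 'rV[R]_n -> 'rV[R]_n,
    (forall m, [fset s_ m j | j in (p0.2 : {fset _})] = (u m).2) &
    forall m j, j \in (p0.2 : {fset _}) -> enorm (s_ m j - j) < e m.
  have ex m := let: And3 _ _ h := uU m in cid2 h.
  exists (fun m => s2val (ex m)) => m; first exact: (s2valP (ex m)).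
  exact: (s2valP' (ex m)).
(* The summand 1 absorbs the distance of [(u m).1.1] from [p0.1.1], which is below [e m <= 1]. *)
pose b := radius + enorm p0.1.1 + 1.
have ub m : radius + enorm (u m).1.1 <= b.
  have [xe _ _] := uU m; have := enormD ((u m).1.1 - p0.1.1) p0.1.1.
  by rewrite subrK /b; move: (e1 m) xe => /=; lra.
have cvgDr (v : nat -> 'rV[R]_n) (a z : 'rV[R]_n) : v @ \oo --> a ->
    (fun m => v m + z) @ \oo --> a + z.
  by move=> va; apply: cvgD => //; exact: cvg_cst.
(* The exceptional translations lie on finitely many spheres, two for each point. *)
have neg (l : seq 'rV[R]_n) : mu.-negligible [set t : n.-tuple mR |
    exists2 q, q \in l & enorm (q + row t) = 0 \/ enorm (q + row t) = radius].
  elim: l => [|q l IH].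
    by apply: (@negligibleS _ _ _ mu set0) (negligible_set0 _) => t [].
  apply: (@negligibleS _ _ _ mu (([set t : n.-tuple mR | enorm (q + row t) = 0] `|`
    [set t : n.-tuple mR | enorm (q + row t) = radius]) `|` _)); last first.
    by apply: negligibleU IH; apply: negligibleU; exact: enorm_eq_negligible.
  move=> t /= [q']; rewrite inE => /orP[/eqP ->|q'l]; first by left.
  by right; exists q'.
have ae_cvg : {ae mu, forall t : n.-tuple mR, setT t ->
    (lift (translate_point (u m) (row t)))%:E @[m --> \oo] -->
      (lift (translate_point p0 (row t)))%:E}.
  apply: negligibleS (neg (ball_points p0)) => t /= ncvg; apply: contrapT => nq.
  apply: ncvg => _; apply: cvg_EFin; first exact: nearW.
  apply: (@lift_kernel_cvg _ _ _ _ theta_bound _ _ K_cont (fun m => (u m).1.1 + row t)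
    (fun m => (u m).1.2 + row t) (fun m => translate (u m).2 (row t))
    (fun m q => s_ m (q - row t) + row t)).
  - by apply: cvgDr; apply: small => m; have [] := uU m.
  - by apply: cvgDr; apply: small => m; have [] := uU m.
  - move=> m; apply/fsetP => x; rewrite /= -(sJ m); apply/imfsetP/imfsetP => /= -[y].
      move=> /imfsetP[z /= zJ ->] ->; rewrite addrK.
      by exists (s_ m z) => //; apply/imfsetP; exists z.
    move=> /imfsetP[z /= zJ ->] ->; exists (z + row t); rewrite ?addrK//.
    by apply/imfsetP; exists z.
  - move=> j /imfsetP[z /= zJ ->]; apply: cvgDr; rewrite addrK; apply: small => m; exact: se.
  - move=> q qp; have [z zp ->] : exists2 z, z \in ball_points p0 & q = z + row t.
      move: qp; rewrite !inE => /orP[/eqP ->|/orP[/eqP ->|]].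
      + by exists p0.1.1 => //; rewrite !inE eqxx.
      + by exists p0.1.2 => //; rewrite !inE eqxx orbT.
      + move=> /imfsetP[z /= zJ ->]; exists z => //.
        by rewrite !inE; apply/orP; right; apply/orP; right.
    by split => zq; apply: nq; exists z => //; [left|right].
have [_ _ cf] := @dominated_convergence _ _ _ mu setT measurableT
  (fun m t => (lift (translate_point (u m) (row t)))%:E)
    (fun t => (lift (translate_point p0 (row t)))%:E)
  (fun t => (C * \1_[set t : n.-tuple mR | enorm (row t) <= b] t)%:E)
  (fun m => measurable_int mu (integrable_lift_translate (u m)))
  (measurable_int mu (integrable_lift_translate p0)) ae_cvg (integrable_enorm_le b)
  (aeW _ (fun t m _ => lift_translate_bound t (ub m))).
apply: (@fine_cvg _ _ _ _ _ (average_kernel p0)).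
rewrite /average_kernel /Rintegral fineK//; apply: integrable_fin_num => //.
exact: integrable_lift_translate.
Unshelve. all: by end_near. Qed.

(** The form is nonnegative for each translation separately, and integration preserves this. *)
Lemma average_kernel_positive_definite (J : indep eadj k) :
  (forall J', positive_definite (fun x y => K (x, y, J'))) ->
  positive_definite (fun x y => average_kernel (x, y, J)).
Proof.
move=> pdK; split=> [x y|F c].
  apply: eq_Rintegral => t _; rewrite /lift_kernel/= andbCA.
  by have [-> _] := pdK (proj_indep n_gt0 theta (translate J (row t))).
have igJ x y (a : R) : mu.-integrable setT
    (EFin \o fun t : n.-tuple mR => a * lift (translate_point (x, y, J) (row t))).
  rewrite (_ : _ \o _ = fun t => a%:E * (lift (translate_point (x, y, J) (row t)))%:E)%E//.
  by apply: integrableZl => //; exact: integrable_lift_translate.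
have igJs x : mu.-integrable setT (EFin \o fun t : n.-tuple mR =>
    \sum_(y <- F) c x * c y * lift (translate_point (x, y, J) (row t))).
  rewrite (_ : _ \o _ = fun t => \sum_(y <- F)
    (c x * c y * lift (translate_point (x, y, J) (row t)))%:E)%E.
    by apply: integrable_sum => // y _; exact: igJ.
  by apply/funext => t; rewrite /= sumEFin.
rewrite [leRHS](_ : _ = \int[mu]_t \sum_(x <- F) \sum_(y <- F)
    c x * c y * lift (translate_point (x, y, J) (row t))); last first.
  rewrite Rintegral_sum//; apply: eq_bigr => x _.
  rewrite Rintegral_sum//; apply: eq_bigr => y _.
  by rewrite RintegralZl//; exact: integrable_lift_translate.
apply: Rintegral_ge0 => t _; set z := row t.
have [JA|JA] := boolP (all (in_ball theta) (enum_fset (translate J z))); last first.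
  rewrite big1// => x _; rewrite big1// => y _.
  by rewrite /lift_kernel/= (negbTE JA) !andbF mulr0.
(* Cutting off outside the ball amounts to giving those points weight 0. *)
pose d x := c x * (in_ball theta (x + z))%:R.
have := @positive_definite_pullback R _ _ _ F d (fun x => proj_sphere n_gt0 (x + z))
  (pdK (proj_indep n_gt0 theta (translate J z))).
congr (0 <= _); apply: eq_bigr => x _; apply: eq_bigr => y _.
rewrite /d /lift_kernel/= JA andbT.
by case: in_ball; case: in_ball; rewrite /= ?mulr1 ?mulr0 ?mul0r.
Qed.

End Average.

Lemma integrable_sum_EFin d (T : measurableType d) (R : realType)
    (mu : {measure set T -> \bar R}) (I : Type) (s : seq I) (P : pred I) (g : I -> T -> R) :
  (forall i, mu.-integrable setT (EFin \o g i)) ->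
  mu.-integrable setT (EFin \o fun t => \sum_(i <- s | P i) g i t).
Proof.
move=> ig; rewrite (_ : _ \o _ = fun t => \sum_(i <- s | P i) (g i t)%:E)%E.
  by apply: integrable_sum => // i _; exact: ig.
by apply/funext => t; rewrite /= sumEFin.
Qed.

Lemma independent_translate (R : realType) n (S : {fset 'rV[R]_n}) z :
  independent (@space_adj R n) S -> independent (@space_adj R n) [fset u + z | u in S].
Proof.
move=> iS; have SS : independent (@space_adj R n) S && (#|` S| <= #|` S|)%N by rewrite iS leqnn.
by have /andP[] := translate_subproof (Indep SS) z.
Qed.

(** * The operator B_k applied to the averaged kernel *)

Section AverageBop.
Variables (R : realType) (n : nat) (n_gt0 : (0 < n)%N) (theta : R).
Hypothesis theta_bound : pi / 3 <= theta <= pi.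
Local Notation S := (@unit_sphere R n).
Local Notation sadj := (@sphere_adj R n theta).
Local Notation eadj := (@space_adj R n).
Local Notation mR := (measurableTypeR R).
Local Notation mu := (lebesgue_tuple R n).
Local Notation row := (@row_of_tuple R n).
Local Notation proj := (proj_sphere n_gt0).
Variables (k : nat) (K : S * S * indep sadj (k - 2) -> R) (C : R).
Hypothesis K_cont : continuous K.
Hypothesis K_bound : forall p, `|K p| <= C.
Local Notation lift := (lift_kernel n_gt0 K).
Local Notation point := ('rV[R]_n * 'rV[R]_n * indep eadj (k - 2))%type.

Let term (J : {fset 'rV[R]_n}) (x y : 'rV[R]_n) (t : n.-tuple mR) : R :=
  oapp (fun J' : indep eadj (k - 2) => lift (translate_point (x, y, J') (row t))) 0 (insub J).

Let integrable_term J x y : mu.-integrable setT (EFin \o term J x y).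
Proof.
rewrite /term; case: insub => /= [J'|]; last exact: integrable0.
exact: (integrable_lift_translate n_gt0 theta_bound K_cont K_bound).
Qed.

Lemma integrable_Bop_lift_translate (F : {fset 'rV[R]_n}) :
  mu.-integrable setT
    (EFin \o fun t => Bop (fun p : point => lift (translate_point p (row t))) F).
Proof.
apply: (@integrable_sum_EFin _ _ _ mu _ _ _ (fun J t => \sum_(x <- F)
  \sum_(y <- F | ([fset x; y] `|` J)%fset == F) term J x y t)) => J.
by do 2 apply: integrable_sum_EFin => ?.
Qed.

Lemma Bop_average_kernel (F : {fset 'rV[R]_n}) :
  Bop (average_kernel n_gt0 K) F =
  \int[mu]_t Bop (fun p : point => lift (translate_point p (row t))) F.
Proof.
rewrite /Bop (@Rintegral_sum _ _ _ mu _ _ _ (fun J t => \sum_(x <- F)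
  \sum_(y <- F | ([fset x; y] `|` J)%fset == F) term J x y t)).
  apply: eq_bigr => J _.
  rewrite (@Rintegral_sum _ _ _ mu _ _ _ (fun x t =>
    \sum_(y <- F | ([fset x; y] `|` J)%fset == F) term J x y t)).
    apply: eq_bigr => x _; rewrite (@Rintegral_sum _ _ _ mu _ _ _ (term J x))//.
    apply: eq_bigr => y _; rewrite /term; case: insub => //=.
    by rewrite /Rintegral integral0.
  by move=> x; apply: integrable_sum_EFin.
by move=> J; do 2 apply: integrable_sum_EFin => ?.
Qed.

(** Each term has [{x, y}] and [J] with union [F], so one point of the translate outside the ball
    kills all terms. Otherwise projection is injective on the translate and carries the sum over to
    the sphere. *)
Lemma Bop_lift_translate (F : {fset 'rV[R]_n}) z : independent eadj F ->
  Bop (fun p : point => lift (translate_point p z)) F =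
  if all (fun u => in_ball theta (u + z)) (enum_fset F)
  then Bop K [fset proj (u + z) | u in F] else 0.
Proof.
move=> iF; have iFz := independent_translate z iF.
case: ifPn => [/allP inF|ninF]; last first.
  apply: Bop_eq0 => x y J xyJ; rewrite /lift_kernel ifN// in_ball_translate.
  apply: contra ninF => /allP h; apply/allP => u; change (u \in F -> in_ball theta (u + z)).
  rewrite -xyJ !inE => uJ; apply: h; rewrite !inE.
  by move: uJ => /orP[/orP[]|] ->; rewrite ?orbT.
have inFz : {in [fset u + z | u in F], forall u, in_ball theta u}.
  by move=> _ /imfsetP[u /= uF ->]; exact: inF.
have projE : [fset proj (u + z) | u in F] = [fset proj v | v in [fset u + z | u in F]].
  by rewrite -imfset_comp.
apply: Bop_imfset => //.
- move=> u v uF vF /(proj_sphere_inj theta_bound iFz inFz) h.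
  by apply: (addIr z); apply: h; apply/imfsetP; [exists u|exists v].
- by rewrite projE; exact: proj_sphere_independent.
move=> x y J J' xF yF /fsubsetP JF JJ'.
have JzF : {in (translate J z : {fset _}), forall u, in_ball theta u}.
  by move=> _ /imfsetP[u /= uJ ->]; apply: inF; exact: JF.
rewrite /lift_kernel ifT/=; last first.
  rewrite (inF x xF) (inF y yF)/=; apply/allP => u uJ; exact: JzF.
congr (K (_, _, _)); apply: val_inj; rewrite /= val_proj_indep//=.
by rewrite -imfset_comp -JJ'.
Qed.

Lemma Bop_lift_translate_fset1 x z :
  Bop (fun p : point => lift (translate_point p z)) [fset x] =
  if in_ball theta (x + z) then Bop K [fset proj (x + z)] else 0.
Proof.
rewrite Bop_lift_translate ?imfset_fset1; last first.
  apply/independentP => u w; rewrite !inE => /eqP -> /eqP ->.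
  by rewrite /space_adj subrr enorm0 ltxx.
congr (if _ then _ else _); apply/allP/idP => [h|h u].
  by apply: h; change (x \in [fset x]); rewrite inE.
by change (u \in [fset x] -> in_ball theta (u + z)); rewrite inE => /eqP ->.
Qed.

(** Joint measurability, needed for Fubini. The two rows are concatenated into one of length
    [n + n], to which the grid criterion applies. *)
Lemma measurable_lift_pair d (T : measurableType d) (u v : T -> 'rV[R]_n) :
  (forall i, measurable_fun setT (fun t => u t 0 i : mR)) ->
  (forall i, measurable_fun setT (fun t => v t 0 i : mR)) ->
  measurable_fun setT (fun t => lift (u t, v t, indep0 eadj (k - 2))).
Proof.
move=> mu' mv.
have mball (w : T -> 'rV[R]_n) : (forall i, measurable_fun setT (fun t => w t 0 i : mR)) ->
    measurable [set t | in_ball theta (w t)].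
  move=> mw; have := measurable_coord_enorm mw measurableT
    (measurable_itv `]0, (sin (theta / 2))^-1[%R).
  by rewrite setTI; congr (measurable _); apply/seteqP; split => t /=; rewrite in_itv.
pose D := [set t | in_ball theta (u t)] `&` [set t | in_ball theta (v t)].
have mD : measurable D by apply: measurableI; exact: mball.
rewrite (_ : (fun _ => _) = (fun t => lift (u t, v t, indep0 eadj (k - 2))) \_ D); last first.
  apply/funext => t; rewrite patchE; case: ifPn => // /negP tD.
  rewrite /lift_kernel ifN//=; apply/negP => /and3P[ut vt _].
  by apply: tD; apply/mem_set; split.
apply/(measurable_restrictT _ mD).
have := @measurable_fun_seq_continuous R (n + n) _ T D (fun t => row_mx (u t) (v t))
  (fun w => lift (lsubmx w, rsubmx w, indep0 eadj (k - 2))).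
rewrite (_ : _ \o _ = fun t => lift (u t, v t, indep0 eadj (k - 2))); last first.
  by apply/funext => t; rewrite /= row_mxKl row_mxKr.
apply=> [i|t [ut vt] w wt].
  rewrite (_ : (fun _ => _) = fun t => match fintype.split i with
    inl j => u t 0 j | inr j => v t 0 j end); last by apply/funext => t; rewrite mxE.
  by case: fintype.split.
have lw : lsubmx (w m) @[m --> \oo] --> u t.
  apply: cvg_row => i.
  rewrite (_ : (fun m => _) = fun m => w m 0 (lshift n i)); last first.
    by apply/funext => m; rewrite mxE.
  rewrite -(row_mxEl (u t) (v t)); exact: cvg_coord wt.
have rw : rsubmx (w m) @[m --> \oo] --> v t.
  apply: cvg_row => i.
  rewrite (_ : (fun m => _) = fun m => w m 0 (rshift n i)); last first.
    by apply/funext => m; rewrite mxE.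
  rewrite -(row_mxEr (u t) (v t)); exact: cvg_coord wt.
rewrite row_mxKl row_mxKr.
apply: (@lift_kernel_cvg _ _ _ _ theta_bound _ _ K_cont (fun m => lsubmx (w m))
  (fun m => rsubmx (w m)) (fun=> indep0 eadj (k - 2)) (fun=> id)) => //.
- by move=> m; rewrite /= imfset0.
- move=> q; rewrite !inE => /orP[/eqP ->|/eqP ->].
  + by move: ut => /andP[q0 qr]; split; apply/eqP; [rewrite gt_eqF|rewrite lt_eqF].
  + by move: vt => /andP[q0 qr]; split; apply/eqP; [rewrite gt_eqF|rewrite lt_eqF].
Qed.

End AverageBop.

(** * Total mass of the averaged kernel *)

Section AverageMass.
Variables (R : realType) (n : nat) (n_gt0 : (0 < n)%N) (theta : R).
Hypothesis theta_bound : pi / 3 <= theta <= pi.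
Local Notation S := (@unit_sphere R n).
Local Notation sadj := (@sphere_adj R n theta).
Local Notation eadj := (@space_adj R n).
Local Notation radius := (sin (theta / 2))^-1.
Local Notation mR := (measurableTypeR R).
Local Notation mu := (lebesgue_tuple R n).
Local Notation row := (@row_of_tuple R n).
Local Notation proj := (proj_sphere n_gt0).
Variables (k : nat) (K : S * S * indep sadj (k - 2) -> R) (C : R).
Hypothesis K_cont : continuous K.
Hypothesis K_bound : forall p, `|K p| <= C.
Local Notation lift2 u v := (lift_kernel n_gt0 K (u, v, indep0 eadj (k - 2))).

Lemma lift2_eq0l (u v : 'rV[R]_n) : ~~ in_ball theta u -> lift2 u v = 0.
Proof. by move=> /negbTE h; rewrite /lift_kernel/= h. Qed.

Lemma lift2_eq0r (u v : 'rV[R]_n) : ~~ in_ball theta v -> lift2 u v = 0.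
Proof. by move=> /negbTE h; rewrite /lift_kernel/= h andbF. Qed.

Lemma lift2_translate (u z : 'rV[R]_n) :
  lift_kernel n_gt0 K (translate_point (u, 0, indep0 eadj (k - 2)) z) = lift2 (u + z) z.
Proof.
rewrite /translate_point/= add0r; congr (lift_kernel _ _ (_, _, _)); apply: val_inj => /=.
by rewrite imfset0.
Qed.

Lemma integrable_prod_bounded (F : n.-tuple mR * n.-tuple mR -> R) (b : R) :
  measurable_fun setT F -> (forall p, `|F p| <= C) ->
  (forall p, F p != 0 -> enorm (row p.1) <= b /\ enorm (row p.2) <= b) ->
  (mu \x mu)%E.-integrable setT (EFin \o F).
Proof.
move=> mF FC Fb; pose B := [set t : n.-tuple mR | enorm (row t) <= b].
have mB : measurable B := @measurable_enorm_le R n b.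
have mBB : measurable (B `*` B) by exact: measurableX.
have intC : (mu \x mu)%E.-integrable setT (fun p => (C * \1_(B `*` B) p)%:E).
  under eq_fun do rewrite EFinM; apply: integrableZl => //.
  apply/integrableP; split; first by apply/measurable_EFinP; exact: measurable_indic.
  under eq_integral do rewrite gee0_abs ?lee_fin//.
  rewrite integral_indic// setIT [X in (X < _)%E](product_measure1E mu mu mB mB).
  rewrite lte_mul_pinfty// ?ge0_fin_numE//; exact: enorm_le_finite.
apply: (le_integrable measurableT _ _ intC); first exact/measurable_EFinP.
move=> p _; rewrite lee_fin; have [->|F0] := eqVneq (F p) 0; first by rewrite normr0.
have [h1 h2] := Fb _ F0; rewrite indicE mem_set//= mulr1.
exact: le_trans (FC p) (ler_norm _).
Qed.

Let radius_ge0 : 0 <= radius.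
Proof. by rewrite invr_ge0 ltW// sin_half_angle_gt0. Qed.

Let lift2_bound (u v : 'rV[R]_n) : `|lift2 u v| <= C.
Proof. exact: (lift_bound n_gt0 K_bound). Qed.

Lemma integrable_lift2 : (mu \x mu)%E.-integrable setT
  (fun p : n.-tuple mR * n.-tuple mR => (lift2 (row p.1) (row p.2))%:E).
Proof.
apply: (@integrable_prod_bounded (fun p => lift2 (row p.1) (row p.2)) radius).
- apply: (measurable_lift_pair n_gt0 theta_bound K_cont) => i.
  + exact: (measurableT_comp (@measurable_row R n i) (@measurable_fst _ _ _ _)).
  + exact: (measurableT_comp (@measurable_row R n i) (@measurable_snd _ _ _ _)).
- by move=> p.
move=> p; have [|/lift2_eq0l ->] := boolP (in_ball theta (row p.1)); last by rewrite eqxx.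
move=> /andP[_ /ltW h1].
have [|/lift2_eq0r ->] := boolP (in_ball theta (row p.2)); last by rewrite eqxx.
by move=> /andP[_ /ltW h2].
Qed.

Lemma integrable_lift2_translate : (mu \x mu)%E.-integrable setT
  (fun p : n.-tuple mR * n.-tuple mR => (lift2 (row p.1 + row p.2) (row p.2))%:E).
Proof.
have m1 i := measurableT_comp (@measurable_row R n i) (@measurable_fst _ _ (n.-tuple mR)
  (n.-tuple mR)).
have m2 i := measurableT_comp (@measurable_row R n i) (@measurable_snd _ _ (n.-tuple mR)
  (n.-tuple mR)).
(* If [x + z] and [z] both lie in the ball, then [x] has norm below [2 * radius]. *)
apply: (@integrable_prod_bounded (fun p => lift2 (row p.1 + row p.2) (row p.2)) (2 * radius)).
- apply: (measurable_lift_pair n_gt0 theta_bound K_cont) => i; last exact: m2.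
  rewrite (_ : (fun _ => _) = fun p => row p.1 0 i + row p.2 0 i).
    by apply: measurable_funD; [exact: m1|exact: m2].
  by apply/funext => p; rewrite mxE.
- by move=> p.
move=> p; have [|/lift2_eq0l ->] := boolP (in_ball theta (row p.1 + row p.2)); last by rewrite eqxx.
move=> /andP[_ h1].
have [|/lift2_eq0r ->] := boolP (in_ball theta (row p.2)); last by rewrite eqxx.
move=> /andP[_ h2] _; have := radius_ge0.
have := enormD (row p.1 + row p.2) (- row p.2); rewrite addrK enormN.
by move: h1 h2 => *; split; lra.
Qed.

(** Before normalization, this is the function whose integral has to be 1 in the definition of
    [Delta_space]. *)
Definition average_slice (t : n.-tuple mR) : R :=
  average_kernel n_gt0 K (row t, 0, indep0 eadj (k - 2)).

Lemma average_sliceE t : (average_slice t)%:E =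
  (\int[mu]_s (lift2 (row t + row s) (row s))%:E)%E.
Proof.
rewrite /average_slice /average_kernel /Rintegral.
rewrite fineK; first by apply: eq_integral => s _; rewrite lift2_translate.
apply: integrable_fin_num => //.
exact: (integrable_lift_translate n_gt0 theta_bound K_cont K_bound).
Qed.

Lemma integrable_average_slice : mu.-integrable setT (EFin \o average_slice).
Proof.
rewrite (_ : _ \o _ = fun t => \int[mu]_s (lift2 (row t + row s) (row s))%:E)%E; last first.
  by apply/funext => t; exact: average_sliceE.
exact: (integrable_fubini_F integrable_lift2_translate).
Qed.

(* Fubini, then the substitution [u = x + z] in the inner integral. *)
Lemma integral_average_slice : (\int[mu]_t (average_slice t)%:E =
  \int[mu \x mu]_p (lift2 (row p.1) (row p.2))%:E)%E.
Proof.
under eq_integral do rewrite average_sliceE.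
rewrite (integral12_prod_meas1 integrable_lift2_translate).
rewrite -(integral21_prod_meas1 integrable_lift2_translate).
rewrite -(integral21_prod_meas1 integrable_lift2).
apply: eq_integral => s _; rewrite /fubini_G/=.
under eq_integral do rewrite addrC.
apply: (integral_translate (row s) (g := fun u => (lift2 u (row s))%:E)).
  apply/measurable_EFinP; apply: (measurable_lift_pair n_gt0 theta_bound K_cont) => i.
    exact: measurable_row.
  exact: measurable_cst.
apply: (le_integrable measurableT _ _ (@integrable_enorm_le R n C radius)).
  apply/measurable_EFinP; apply: (measurable_lift_pair n_gt0 theta_bound K_cont) => i.
    exact: measurable_row.
  exact: measurable_cst.
move=> t _; rewrite lee_fin /=; have [/andP[_ /ltW tb]|/lift2_eq0l ->] :=
  boolP (in_ball theta (row t)); last by rewrite normr0.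
by rewrite indicE mem_set// mulr1 (le_trans (lift2_bound _ _))// ler_norm.
Qed.

(** At the empty set and on pairs from the ball the lift is 1 plus the pullback of [K0]. The 1
    contributes the squared volume, the pullback a nonnegative double integral. *)
Lemma average_slice_mass_ge (K0 : S * S * indep sadj (k - 2) -> R) (C0 : R) :
  (forall p, K p = K0 p + empty_indicator R p) ->
  continuous K0 -> (forall p, `|K0 p| <= C0) ->
  (forall J, positive_definite (fun x y => K0 (x, y, J))) ->
  (mu [set t : n.-tuple mR | in_ball theta (row t)] *
   mu [set t : n.-tuple mR | in_ball theta (row t)] <=
   \int[mu]_t (average_slice t)%:E)%E.
Proof.
move=> KE K0_cont K0_bound K0_pd; rewrite integral_average_slice.
pose A := [set u : 'rV[R]_n | in_ball theta u].
pose E := [set t : n.-tuple mR | A (row t)].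
pose k0 u v := K0 (proj u, proj v, indep0 sadj (k - 2)).
have mE : measurable E := @measurable_punctured_ball R n radius.
have mEE : measurable (E `*` E) by exact: measurableX.
have lift2E p : lift2 (row p.1) (row p.2) =
    \1_(E `*` E) p + \1_(E `*` E) p * k0 (row p.1) (row p.2).
  have [[E1 E2]|nE] := pselect ((E `*` E) p); last first.
    rewrite indicE memNset// mul0r addr0.
    have [h1|/lift2_eq0l ->//] := boolP (in_ball theta (row p.1)).
    by have [h2|/lift2_eq0r ->//] := boolP (in_ball theta (row p.2)); case: nE.
  rewrite indicE mem_set// mul1r /lift_kernel ifT/=; last by rewrite E1 E2.
  by rewrite KE (proj_indep0 n_gt0 theta_bound) /empty_indicator/= addrC.
have i1 : (mu \x mu)%E.-integrable setT (fun p => (\1_(E `*` E) p : R)%:E).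
  apply/integrableP; split; first by apply/measurable_EFinP; exact: measurable_indic.
  under eq_integral do rewrite gee0_abs ?lee_fin//.
  rewrite integral_indic// setIT [X in (X < _)%E](product_measure1E mu mu mE mE).
  by rewrite lte_mul_pinfty// -?ge0_fin_numE//; exact: ball_measure_finite.
have i2 : (mu \x mu)%E.-integrable setT
    (fun p => (\1_(E `*` E) p * k0 (row p.1) (row p.2))%:E).
  rewrite (_ : (fun _ => _) = (fun p => (lift2 (row p.1) (row p.2))%:E) \-
    (fun p => (\1_(E `*` E) p : R)%:E))%E.
    by apply: integrableB => //; exact: integrable_lift2.
  by apply/funext => p; rewrite /= lift2E -EFinB addrAC subrr add0r.
under eq_integral do rewrite lift2E EFinD.
rewrite integralD// integral_indic// setIT.
rewrite [X in (_ <= X + _)%E](product_measure1E mu mu mE mE) leeDl//.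
(* As [proj] is total, positivity and the bound for [k0] hold on all rows; continuity is asked only
   at points of [A], which are nonzero. *)
apply: (@positive_definite_integral_ge0 R n A k0 radius C0) => //.
- by move=> u /andP[_ /ltW].
- move=> I c w; have := positive_definite_pullback [fset i | i in I] c (proj \o w)
    (K0_pd (indep0 sadj (k - 2))).
  rewrite big_imfset//= big_enum/=; congr (_ <= _); apply: eq_bigr => i _.
  by rewrite big_imfset//= big_enum.
- by move=> u v; exact: K0_bound.
- move=> u v u_ v_ /andP[u0 _] /andP[v0 _] uu vv.
  rewrite enorm_gt0 in u0; rewrite enorm_gt0 in v0.
  have cK := @K0_cont (proj u, proj v, indep0 sadj (k - 2)).
  have cJ : (fun _ : nat => indep0 sadj (k - 2)) @ \oo --> indep0 sadj (k - 2).
    exact: cvg_cst.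
  have cu := cvg_proj_sphere (n_gt0 := n_gt0) u0 uu.
  have cv := cvg_proj_sphere (n_gt0 := n_gt0) v0 vv.
  exact: (cvg_comp _ K0 (cvg_pair (cvg_pair cu cv) cJ) cK).
Qed.

End AverageMass.

(** * The bound *)

Lemma BopZ (R : realType) (V : choiceType) (adj : rel V) k (c : R)
    (T : V * V * indep adj (k - 2) -> R) S :
  Bop (fun p => c * T p) S = c * Bop T S.
Proof.
rewrite /Bop mulr_sumr; apply: eq_bigr => J _; rewrite mulr_sumr.
apply: eq_bigr => x _; rewrite mulr_sumr; apply: eq_bigr => y _.
by case: insub => //=; rewrite mulr0.
Qed.

(** The empty set is isolated: pulled back to tuples, the indicator is constant, equal to 1 for
    [k = 0] and to 0 for [k > 0]. *)
Lemma empty_indicator_continuous (R : realType) (V : topologicalType) (adj : rel V) k :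
  continuous (@empty_indicator R V adj k).
Proof.
have cg : continuous (fun J : indep adj k => ((J : {fset V}) == fset0)%:R : R).
  apply/continuousP => U _; rewrite /open/= /indep_open/=.
  have pE (t : @indep_tuple V adj k) : (points (val t) == fset0) = (k == 0%N).
    case: k t => [|m] t.
      by rewrite eqxx; apply/eqP/fsetP => x; rewrite inE; apply/negP => /mem_points[[]].
    apply/negbTE/eqP => /fsetP/(_ (val t ord0)); rewrite inE => /negP[].
    by apply/mem_points; exists ord0.
  have [Uk|nUk] := pselect (U (k == 0%N)%:R).
    rewrite (_ : _ @^-1` _ = setT); first exact: openT.
    by apply/seteqP; split => // t _; rewrite /= pE.
  rewrite (_ : _ @^-1` _ = set0); first exact: open0.
  by apply/seteqP; split => // t; rewrite /= pE.
have csnd : continuous (snd : V * V * indep adj k -> indep adj k).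
  by move=> p; exact: cvg_snd.
by move=> p; exact: (cvg_comp _ _ (csnd p) (cg p.2)).
Qed.

Lemma positive_definiteDcst (R : realType) (V : choiceType) (K : V -> V -> R) (a : R) :
  0 <= a -> positive_definite K -> positive_definite (fun x y => K x y + a).
Proof.
move=> a0 [sK pK]; split=> [x y|F c]; first by rewrite sK.
rewrite (_ : \sum_(_ <- _) _ = \sum_(x <- F) \sum_(y <- F) c x * c y * K x y +
   a * (\sum_(x <- F) c x) ^+ 2); first by rewrite addr_ge0// mulr_ge0// sqr_ge0.
rewrite expr2 mulr_suml mulr_sumr -big_split; apply: eq_bigr => x _.
rewrite /= mulr_sumr mulr_sumr -big_split; apply: eq_bigr => y _ /=; ring.
Qed.

Lemma positive_definiteZ (R : realType) (V : choiceType) (K : V -> V -> R) (a : R) :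
  0 <= a -> positive_definite K -> positive_definite (fun x y => a * K x y).
Proof.
move=> a0 [sK pK]; split=> [x y|F c]; first by rewrite sK.
rewrite (_ : \sum_(_ <- _) _ = a * \sum_(x <- F) \sum_(y <- F) c x * c y * K x y).
  by rewrite mulr_ge0.
rewrite mulr_sumr; apply: eq_bigr => x _; rewrite mulr_sumr; apply: eq_bigr => y _; ring.
Qed.

Lemma Rintegral_le0 d (T : measurableType d) (R : realType)
    (mu : {measure set T -> \bar R}) (g : T -> R) :
  (forall t, g t <= 0) -> \int[mu]_t g t <= 0.
Proof.
move=> g0; rewrite /Rintegral; apply: fine_le0.
under eq_integral do rewrite -[g _]opprK EFinN.
rewrite integral_ge0N ?oppe_le0; first by apply: integral_ge0 => t _; rewrite lee_fin oppr_ge0.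
by move=> t _; rewrite lee_fin oppr_ge0.
Qed.

Lemma Rintegral_le_indic d (T : measurableType d) (R : realType)
    (mu : {measure set T -> \bar R}) (B : set T) (g : T -> R) (a b : R) :
  measurable B -> mu B = b%:E -> mu.-integrable setT (EFin \o g) ->
  (forall t, g t <= a * \1_B t) -> \int[mu]_t g t <= a * b.
Proof.
move=> mB muB ig gB.
have i1 : mu.-integrable setT (fun t => (\1_B t : R)%:E).
  apply/integrableP; split; first by apply/measurable_EFinP; exact: measurable_indic.
  under eq_integral do rewrite gee0_abs ?lee_fin//.
  by rewrite integral_indic// setIT muB ltry.
have -> : a * b = \int[mu]_t (a * \1_B t).
  by rewrite RintegralZl// /Rintegral integral_indic// setIT muB.
apply: le_Rintegral => //.
by apply: eq_integrable (integrableZl measurableT a i1).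
Qed.

Lemma card_fset2_ex (T : choiceType) (F : {fset T}) : 2%N = #|` F| ->
  exists x y, x != y /\ F = [fset x; y].
Proof.
have := fset_uniq F; have inF z : (z \in F) = (z \in enum_fset F) by [].
case: (enum_fset F) inF => [|x [|y []]] //= inF; rewrite inE andbT => xy _.
by exists x, y; split => //; apply/fsetP => z; rewrite inF !inE.
Qed.

(** * From a feasible kernel on the sphere to one on Euclidean space *)

Section SphereToSpace.
Variables (R : realType) (n k : nat) (theta M : R).
Hypotheses (n_gt0 : (0 < n)%N) (theta_bound : pi / 3 <= theta <= pi).
Local Notation S := (@unit_sphere R n).
Local Notation sadj := (@sphere_adj R n theta).
Local Notation eadj := (@space_adj R n).
Local Notation radius := (sin (theta / 2))^-1.
Local Notation mR := (measurableTypeR R).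
Local Notation mu := (lebesgue_tuple R n).
Local Notation row := (@row_of_tuple R n).
Variable K0 : S * S * indep sadj (k - 2) -> R.
Hypothesis K0_cont : continuous K0.
Hypothesis K0_pd : forall J, positive_definite (fun x y => K0 (x, y, J)).
Hypothesis K0_1 : forall x, Bop K0 [fset x] <= M - 1.
Hypothesis K0_2 : forall x y, x != y -> independent sadj [fset x; y] -> Bop K0 [fset x; y] <= - 2.
Hypothesis K0_3 : forall F : indep sadj k, (3 <= #|` F|)%N -> Bop K0 F <= 0.

(* [B_k] of the indicator of [J = fset0] is 1, 2 and 0 on sets with one, two and at least
   three elements, so it absorbs the constants -1 and -2 of the constraints on [K0]. *)
Let K p := K0 p + empty_indicator R p.

Let K_cont : continuous K.
Proof. by move=> p; apply: cvgD; [exact: K0_cont|exact: empty_indicator_continuous]. Qed.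

Let K_pd J : positive_definite (fun x y => K (x, y, J)).
Proof. by apply: positive_definiteDcst. Qed.

Let K_1 x : Bop K [fset x] <= M.
Proof. by rewrite BopD Bop_empty_indicator1 -lerBrDr. Qed.

Let K_ge2 (F : indep sadj k) : (2 <= #|` F|)%N -> Bop K F <= 0.
Proof.
rewrite leq_eqVlt BopD => /orP[F2|F3]; last by rewrite Bop_empty_indicator3// addr0 K0_3.
have [x [y [xy FE]]] := card_fset2_ex (eqP F2).
have /andP[iF _] := indepP F; rewrite FE in iF *.
by rewrite Bop_empty_indicator2// -lerBrDr sub0r K0_2.
Qed.

(** The final estimate multiplies [v ^+ 2 / mass <= 1] by [M], which requires this sign. Any point
    of the sphere serves as a witness. *)
Let M_ge0 : 0 <= M.
Proof. by apply: le_trans (K_1 (proj_sphere n_gt0 0)); exact: Bop_singleton_ge0. Qed.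

Local Notation ball := [set t : n.-tuple mR | in_ball theta (row t)].
Let s := sin (theta / 2).
Let v := fine (mu ball).

Let s_gt0 : 0 < s.
Proof. exact: sin_half_angle_gt0. Qed.

Let muE : mu ball = v%:E.
Proof. by rewrite fineK//; exact: ball_measure_finite. Qed.

Let v_gt0 : 0 < v.
Proof. by rewrite -lte_fin -muE; apply: ball_measure_gt0; rewrite ?invr_gt0. Qed.

Let mass := \int[mu]_t average_slice n_gt0 K t.

Let bounds : exists C0 C, (forall p, `|K0 p| <= C0) /\ (forall p, `|K p| <= C).
Proof.
have [C0 hC0] := sphere_kernel_bounded (angle_bound theta_bound) K0_cont.
have [C hC] := sphere_kernel_bounded (angle_bound theta_bound) K_cont.
by exists C0, C.
Qed.

Let massE : (\int[mu]_t (average_slice n_gt0 K t)%:E = mass%:E)%E.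
Proof.
have [C0 [C [hC0 hC]]] := bounds.
rewrite /mass /Rintegral fineK//; apply: integrable_fin_num => //.
exact: (integrable_average_slice n_gt0 theta_bound K_cont hC).
Qed.

Let mass_ge : v ^+ 2 <= mass.
Proof.
have [C0 [C [hC0 hC]]] := bounds.
have := average_slice_mass_ge n_gt0 theta_bound K_cont hC (fun=> erefl) K0_cont hC0 K0_pd.
by rewrite massE muE -EFinM lee_fin.
Qed.

Let mass_gt0 : 0 < mass.
Proof. by rewrite (lt_le_trans _ mass_ge)// exprn_gt0. Qed.

Lemma Delta_space_le : (Delta_space R k n <= (s ^+ n * M)%:E)%E.
Proof.
have [C0 [C [hC0 hC]]] := bounds.
pose f p := mass^-1 * average_kernel n_gt0 K p.
have Bf F : Bop f F = mass^-1 * \int[mu]_t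
    Bop (fun p : 'rV[R]_n * 'rV[R]_n * indep eadj (k - 2) =>
           lift_kernel n_gt0 K (translate_point p (row t))) F.
  by rewrite BopZ (Bop_average_kernel n_gt0 theta_bound K_cont hC).
apply: (@le_trans _ _ (vol (@unit_ball R n) * (Bop f [fset 0%R])%:E)%E).
  apply: ereal_inf_lbound; exists f; last reflexivity.
  split.
  - have cA := @average_kernel_continuous R n n_gt0 theta theta_bound (k - 2) K C K_cont hC.
    by move=> p; apply: cvgM; [exact: cvg_cst|exact: cA].
  - move=> x y z J; congr (_ * _).
    exact/esym/(@average_kernel_translate R n n_gt0 theta theta_bound (k - 2) K C K_cont hC (x,
      y, J)).
  - move=> J; apply: positive_definiteZ; first by rewrite invr_ge0 ltW.
    exact: (@average_kernel_positive_definite R n n_gt0 theta theta_bound (k - 2) K C K_cont hC).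
  (* A translate of [F] inside the ball projects to a spherical code with as many points as [F], so
     [K_ge2] applies to it. *)
  - move=> F F2; rewrite Bf pmulr_rle0 ?invr_gt0//; apply: Rintegral_le0 => t.
    have /andP[iF Fk] := indepP F; rewrite (Bop_lift_translate n_gt0 theta_bound)//.
    case: ifPn => // /allP inF.
    have iFz := independent_translate (row t) iF.
    have inFz : {in [fset u + row t | u in (F : {fset _})], forall u, in_ball theta u}.
      by move=> _ /imfsetP[u /= uF ->]; exact: inF.
    have projE : [fset proj_sphere n_gt0 (u + row t) | u in (F : {fset _})] =
        [fset proj_sphere n_gt0 w | w in [fset u + row t | u in (F : {fset _})]].
      by rewrite -imfset_comp.
    have cardE : #|` [fset proj_sphere n_gt0 (u + row t) | u in (F : {fset _})]| = #|` F|.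
      rewrite projE (card_imfset_sub (proj_sphere_inj theta_bound iFz inFz))//.
      by rewrite (card_imfset_sub (S := F))// => u w _ _; exact: addIr.
    have iP : independent sadj [fset proj_sphere n_gt0 (u + row t) | u in (F : {fset _})] &&
       (#|` [fset proj_sphere n_gt0 (u + row t) | u in (F : {fset _})]| <= k)%N.
      by rewrite cardE Fk projE proj_sphere_independent.
    by apply: (K_ge2 (F := Indep iP)); rewrite /= cardE.
  - have igs := integrable_average_slice n_gt0 theta_bound K_cont hC.
    split; first by apply: (integrableZl measurableT mass^-1 igs).
    transitivity (\int[mu]_t (mass^-1%:E * (average_slice n_gt0 K t)%:E))%E; first by [].
    by rewrite integralZl// massE -EFinM mulVf// gt_eqF.
have r_gt0 : 0 < radius by rewrite invr_gt0.
rewrite (vol_unit_ball_scale n_gt0 r_gt0) (_ : mu _ = v%:E)//.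
rewrite -!EFinM lee_fin exprVn invrK -mulrA ler_pM2l ?exprn_gt0//.
have Bf0 : Bop f [fset 0] <= mass^-1 * (v * M).
  rewrite Bf ler_pM2l ?invr_gt0//.
  have mball : measurable ball := @measurable_punctured_ball R n radius.
  (* The integrand is at most [M] if the translate of the origin lies in the ball, and 0
     otherwise. *)
  rewrite mulrC; apply: (Rintegral_le_indic mball muE).
    exact: (@integrable_Bop_lift_translate R n n_gt0 theta theta_bound k K C K_cont hC).
  move=> t; rewrite (Bop_lift_translate_fset1 n_gt0 theta_bound) add0r indicE.
  have [tb|tb] := boolP (in_ball theta (row t)).
    by rewrite (mem_set (tb : ball t)) mulr1.
  by rewrite (memNset (A := ball)) ?mulr0//; exact/negP.
apply: (@le_trans _ _ (v * (mass^-1 * (v * M)))); first by rewrite ler_pM2l.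
(* The first factor is at most 1 by [mass_ge]. *)
rewrite (_ : v * _ = v ^+ 2 / mass * M); last by ring.
by rewrite ler_piMl// ler_pdivrMr// mul1r.
Qed.

End SphereToSpace.

Theorem theorem2p5 (R : realType) (n k : nat) (theta : R) :
  (1 <= n)%N -> (2 <= k)%N -> pi / 3 <= theta <= pi ->
  (Delta_space R k n <=
     (sin (theta / 2) ^+ n)%:E * Delta_sphere k n theta)%E.
Proof.
move=> n1 _ theta_bound.
have s0 : 0 < sin (theta / 2) ^+ n by rewrite exprn_gt0// sin_half_angle_gt0.
(* Dividing by the positive power of the sine leaves a lower bound for an infimum, so each feasible
   pair of [M] and [K] can be treated on its own. *)
rewrite -lee_pdivrMl//; apply: le_ereal_inf_tmp => _ [M [K [cK pdK K1 K2 K3]] <-].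
rewrite lee_pdivrMl// -EFinM; exact: (Delta_space_le n1 theta_bound cK pdK K1 K2 K3).
Qed.
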